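(* For any connected compact Lie group $G$, there is a constant $c_G>0$ such that for every nontrivial irreducible character $\chi$ of $G$, there exists $g\in G$ with $$\operatorname{Re}\chi(g)\le -c_G\,\chi(1).$$
   Context: An irreducible character is the trace function $\chi=\operatorname{Tr}\rho$ of an irreducible finite-dimensional continuous complex representation $\rho$ of $G$; it is nontrivial if $\rho$ is not the trivial representation. *)

(* Defs.v *)
From HB Require Import structures.
From mathcomp Require Import all_boot all_order all_algebra.
From mathcomp Require Import complex.
From mathcomp Require Import all_classical all_reals all_analysis.
Set Implicit Arguments.
Unset Strict Implicit.
Unset Printing Implicit Defensive.
Import Order.TTheory GRing.Theory Num.Theory.
Import numFieldNormedType.Exports.
Local Open Scope classical_set_scope.
Local Open Scope complex_scope.
Local Open Scope ring_scope.

Section Smoothness.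
Context {R : realType}.

(* [Ck_on k U f]: f is k times continuously differentiable on U. It is meant
   for U open, where 'D_v f on U depends only on the values of f on U. *)
Fixpoint Ck_on {V W : normedModType R} (k : nat) (U : set V) (f : V -> W) :
    Prop :=
  if k is k'.+1 then
    (forall x, U x -> differentiable f x) /\
    (forall v : V, Ck_on k' U (fun x => 'D_v f x))
  else forall x, U x -> {for x, continuous f}.

Definition smooth_on {V W : normedModType R} (U : set V) (f : V -> W) : Prop :=
  forall k, Ck_on k U f.

(* The values of [chart_fun] outside [chart_dom], and of [chart_inv] outside
   [chart_cod], are irrelevant. *)
Record chart (E : normedModType R) (T : topologicalType) := Chart {
  chart_dom : set T;
  chart_cod : set E;
  chart_fun :> T -> E;
  chart_inv : E -> T }.

Definition is_chart {E : normedModType R} {T : topologicalType}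
    (c : chart E T) : Prop :=
  [/\ open (chart_dom c) /\ open (chart_cod c),
      (forall x, chart_dom c x -> chart_cod c (c x)) /\
      (forall y, chart_cod c y -> chart_dom c (chart_inv c y)),
      (forall x, chart_dom c x -> chart_inv c (c x) = x) /\
      (forall y, chart_cod c y -> c (chart_inv c y) = y) &
      (forall x, chart_dom c x -> {for x, continuous c}) /\
      (forall y, chart_cod c y -> {for y, continuous (chart_inv c)})].

Definition smooth_atlas {E : normedModType R} {T : topologicalType}
    (A : set (chart E T)) : Prop :=
  [/\ forall c, A c -> is_chart c,
      forall x, exists2 c, A c & chart_dom c x &
      forall c c', A c -> A c' ->
        smooth_on (chart_cod c `&` chart_inv c @^-1` chart_dom c')
                  (c' \o chart_inv c)].

Definition prod_chart {E E' : normedModType R} {T T' : topologicalType}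
    (c : chart E T) (c' : chart E' T') : chart (E * E')%type (T * T')%type :=
  Chart (chart_dom c `*` chart_dom c') (chart_cod c `*` chart_cod c')
        (fun p => (c p.1, c' p.2))
        (fun q => (chart_inv c q.1, chart_inv c' q.2)).

Definition prod_atlas {E E' : normedModType R} {T T' : topologicalType}
    (A : set (chart E T)) (A' : set (chart E' T')) :
    set (chart (E * E')%type (T * T')%type) :=
  [set p | exists c c', [/\ A c, A' c' & p = prod_chart c c']].

Definition smooth_map {E E' : normedModType R} {T T' : topologicalType}
    (A : set (chart E T)) (A' : set (chart E' T')) (f : T -> T') : Prop :=
  continuous f /\
  forall c c', A c -> A' c' ->
    smooth_on (chart_cod c `&` (f \o chart_inv c) @^-1` chart_dom c')
              (c' \o f \o chart_inv c).

End Smoothness.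

(* The smooth structure is given by an atlas that need not be maximal. *)
HB.mixin Record isLieGroup (R : realType) (d : nat) G
    of Group G & Topological G := {
  lie_atlas : set (chart 'rV[R]_d G);
  lie_hausdorff : hausdorff_space G;
  lie_second_countable : @second_countable G;
  lie_smooth_atlas : smooth_atlas lie_atlas;
  lie_mul_smooth : smooth_map (prod_atlas lie_atlas lie_atlas) lie_atlas
                     (fun p : G * G => (p.1 * p.2)%g);
  lie_inv_smooth : smooth_map lie_atlas lie_atlas (fun x : G => x^-1%g) }.

#[short(type="lieGroupType")]
HB.structure Definition LieGroup (R : realType) (d : nat) :=
  { G of Group G & Topological G & isLieGroup R d G }.

Section Representations.
Context {R : realType} {d : nat} {G : lieGroupType R d}.

Definition continuous_repr {n : nat} (rho : G -> 'M[R[i]]_n) : Prop :=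
  [/\ rho 1%g = 1%:M,
      forall g h, rho (g * h)%g = rho g *m rho h &
      continuous (rho : G -> 'M[(R[i] : numFieldType)]_n)].

Definition irreducible_repr {n : nat} (rho : G -> 'M[R[i]]_n) : Prop :=
  (0 < n)%N /\
  forall U : {vspace 'cV[R[i]]_n},
    (forall g v, v \in U -> rho g *m v \in U) -> U = 0%VS \/ U = fullv.

Definition trivial_repr {n : nat} (rho : G -> 'M[R[i]]_n) : Prop :=
  n = 1%N /\ forall g, rho g = 1%:M.

Definition nontrivial_irreducible_character (chi : G -> R[i]) : Prop :=
  exists n (rho : G -> 'M[R[i]]_n),
    [/\ continuous_repr rho, irreducible_repr rho, ~ trivial_repr rho &
        forall g, chi g = \tr (rho g)].

End Representations.

(* Main.v *)
(* Write f = Tr(rho)/n, and suppose Re f > - e on G.  The scale of rho is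
   the largest r such that Re f >= 1/2 on the ball of radius r around 1 in a chart;
   so Re f x <= 1/2 for some x at distance about r.  Averaging over conjugates of x
   and x^-1 turns (rho x + rho x^-1)/2 into the scalar Re f x, by Schur's lemma; hence
   for independent random words X, Y of length m in these conjugates the mean of
   f (X^-1 Y) is (Re f x)^(2m) <= 4^-m (as long as Re f x >= -1/2).  On the other hand
   the words of length m stay in a ball of radius O(m r), which is covered by
   N = O(m^d) cells of size so small that X^-1 Y lies in the ball of radius r whenever
   X and Y share a cell.  This happens with probability at least 1/N, so the mean is at
   least 1/(2N) - e.  For m large, depending on G only, 4^-m < 1/(4N), which forces
   e > 1/(4N).  If Re f >= 1/2 on a whole fixed neighbourhood of 1, the same argument
   works with a finite cover of G by translates of a smaller neighbourhood.

   No Haar measure is needed: exact averages over G are replaced by limits of averages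
   over finite families. *)
Require Import Defs.
From HB Require Import structures.
From mathcomp Require Import all_boot all_order all_algebra.
From mathcomp Require Import complex.
From mathcomp Require Import all_classical all_reals all_analysis.
From mathcomp Require Import zify ring lra.
Set Implicit Arguments.
Unset Strict Implicit.
Unset Printing Implicit Defensive.
Import Order.TTheory GRing.Theory Num.Theory.
Import numFieldNormedType.Exports.
Local Open Scope classical_set_scope.
Local Open Scope complex_scope.
Local Open Scope ring_scope.

(** * Limits of complex sequences and matrices *)

Section ComplexSquareNorm.
Context {R : realType}.
Implicit Types (x y z : R[i]).

Definition sqnormc z : R := complex.Re z ^+ 2 + complex.Im z ^+ 2.

Lemma sqnormc_ge0 z : 0 <= sqnormc z.
Proof. by rewrite addr_ge0 ?sqr_ge0. Qed.

Lemma sqnormcM x y : sqnormc (x * y) = sqnormc x * sqnormc y.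
Proof. by case: x y => [a b] [c d]; rewrite /sqnormc /=; ring. Qed.

Lemma sqnormcX x k : sqnormc (x ^+ k) = sqnormc x ^+ k.
Proof.
elim: k => [|k IH]; last by rewrite !exprS sqnormcM IH.
by rewrite !expr0 /sqnormc /= expr1n expr0n addr0.
Qed.

Lemma sqnormcN z : sqnormc (- z) = sqnormc z.
Proof. by case: z => a b; rewrite /sqnormc /= !sqrrN. Qed.

Lemma sqnormcD_le x y : sqnormc (x + y) <= 2 * (sqnormc x + sqnormc y).
Proof.
case: x y => [a b] [c d]; rewrite /sqnormc /= -subr_ge0.
suff -> : 2 * (a ^+ 2 + b ^+ 2 + (c ^+ 2 + d ^+ 2)) - ((a + c) ^+ 2 + (b + d) ^+ 2)
    = (a - c) ^+ 2 + (b - d) ^+ 2 by rewrite addr_ge0 ?sqr_ge0.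
ring.
Qed.

(** Each further term doubles the constant of the two-term bound; only its independence of [F]
    matters later. *)
Lemma sqnormc_sum_le (I : Type) (r : seq I) (F : I -> R[i]) :
  sqnormc (\sum_(i <- r) F i) <= 2 ^+ size r * \sum_(i <- r) sqnormc (F i).
Proof.
elim: r => [|i r IH]; first by rewrite !big_nil mulr0 /sqnormc /= expr0n addr0.
rewrite !big_cons; apply: le_trans (sqnormcD_le _ _) _.
rewrite /= exprS -mulrA ler_pM2l// mulrDr lerD// ler_peMl ?sqnormc_ge0//.
by rewrite exprn_ege1// ler1n.
Qed.

Lemma normc_le_ReIm z : `|z| <= (`|complex.Re z| + `|complex.Im z|)%:C.
Proof.
case: z => a b; rewrite normc_def lecR /= -[leRHS]ger0_norm ?addr_ge0 //.
rewrite -sqrtr_sqr; apply: ler_wsqrtr; rewrite sqrrD !real_normK ?num_real //.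
by rewrite lerD2r lerDl mulrn_wge0 // mulr_ge0.
Qed.

Lemma normc_ge_Re z : `|complex.Re z|%:C <= `|z|.
Proof.
case: z => a b; rewrite normc_def lecR /= -sqrtr_sqr; apply: ler_wsqrtr.
by rewrite lerDl sqr_ge0.
Qed.

Lemma normc_ge_Im z : `|complex.Im z|%:C <= `|z|.
Proof.
case: z => a b; rewrite normc_def lecR /= -sqrtr_sqr; apply: ler_wsqrtr.
by rewrite lerDr sqr_ge0.
Qed.

End ComplexSquareNorm.

Section ComplexLimits.
Context {R : realType}.
Local Notation C := (R[i] : numFieldType).

Lemma cvg_complex (u : nat -> C) (l : C) :
  (fun k => complex.Re (u k)) @ \oo --> complex.Re l ->
  (fun k => complex.Im (u k)) @ \oo --> complex.Im l -> u @ \oo --> l.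
Proof.
move=> /cvgrPdist_lt uRe /cvgrPdist_lt uIm; apply/cvgrPdist_lt => e e0.
(* In the order of [C] a positive element is real, so [e] becomes a real radius. *)
have [r r0 ->] : exists2 r : R, 0 < r & e = r%:C.
  by case: e e0 => a b; rewrite ltcE /= => /andP[/eqP -> ?]; exists a.
have r20 : 0 < r / 2 by rewrite divr_gt0.
near=> k; apply: le_lt_trans (normc_le_ReIm _) _; rewrite ltcR.
rewrite !raddfB /= [ltRHS]splitr ltrD //.
  by near: k; exact: uRe.
by near: k; exact: uIm.
Unshelve. all: by end_near. Qed.

Lemma cvg_Re (T : Type) (F : set_system T) {FF : Filter F} (u : T -> C) (l : C) :
  u @ F --> l -> (fun t => complex.Re (u t)) @ F --> complex.Re l.
Proof.
move=> /cvgrPdist_lt ul; apply/cvgrPdist_lt => e e0.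
have /ul : (0 : C) < e%:C by rewrite ltcR.
apply: filterS => t; rewrite -ltcR; apply: le_lt_trans.
by rewrite -raddfB normc_ge_Re.
Qed.

Lemma cvg_Im (T : Type) (F : set_system T) {FF : Filter F} (u : T -> C) (l : C) :
  u @ F --> l -> (fun t => complex.Im (u t)) @ F --> complex.Im l.
Proof.
move=> /cvgrPdist_lt ul; apply/cvgrPdist_lt => e e0.
have /ul : (0 : C) < e%:C by rewrite ltcR.
apply: filterS => t; rewrite -ltcR; apply: le_lt_trans.
by rewrite -raddfB normc_ge_Im.
Qed.

(** The hypothesis has the shape that convexity gives for a minimising sequence: squared distances
    are controlled by the defects from the infimum. *)
Lemma cauchy_cvg_of_sq (u : nat -> R) (K : R) :
  (forall k l, (u k - u l) ^+ 2 <= K * (k.+1%:R^-1 + l.+1%:R^-1)) ->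
  exists l : R, u @ \oo --> l.
Proof.
move=> uK; suff : cvg (u @ \oo) by move=> ?; exists (lim (u @ \oo)).
apply/cauchy_cvgP/cauchy_exP => e e0.
have K0 : 0 <= K.
  by have := le_trans (sqr_ge0 _) (uK 0%N 0%N); rewrite pmulr_lge0 // addr_gt0.
have : \forall k \near \oo, K * 2 * k.+1%:R^-1 < e ^+ 2.
  have : (fun k => K * 2 * k.+1%:R^-1) @ \oo --> K * 2 * 0.
    by apply: cvgMr; exact: cvg_harmonic.
  rewrite mulr0 => /cvgrPdist_lt /(_ _ (exprn_gt0 2 e0)).
  apply: filterS => k; rewrite sub0r normrN; apply: le_lt_trans; exact: ler_norm.
move=> [N _ /(_ N (leqnn N)) /= HN].
exists (u N); exists N => // k /= Nk; rewrite /ball /=.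
rewrite -ltr_sqr ?nnegrE ?normr_ge0 ?ltW // real_normK ?num_real //.
apply: le_lt_trans (uK _ _) (le_lt_trans _ HN).
rewrite -mulrA ler_wpM2l // mulrDl mul1r lerD2l.
by rewrite lef_pV2 ?posrE // ler_nat ltnS.
Qed.

End ComplexLimits.

Section MatrixLimits.
Context {K : numFieldType}.

Definition mxcvg {m n} (U : nat -> 'M[K]_(m, n)) (L : 'M[K]_(m, n)) : Prop :=
  forall i j, (fun k => U k i j) @ \oo --> L i j.

Lemma mxcvg_cst m n (A : 'M[K]_(m, n)) : mxcvg (fun=> A) A.
Proof. by move=> i j; exact: cvg_cst. Qed.

Lemma mxcvgM m n p (U : nat -> 'M[K]_(m, n)) (V : nat -> 'M[K]_(n, p)) A B :
  mxcvg U A -> mxcvg V B -> mxcvg (fun k => U k *m V k) (A *m B).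
Proof.
move=> UA VB i j; rewrite mxE; under eq_fun do rewrite mxE.
apply: (@cvg_big K _ +%R 0 xpredT) => [|l _]; first exact: add_continuous.
exact: cvgM.
Qed.

Lemma mxcvgB m n (U V : nat -> 'M[K]_(m, n)) A B :
  mxcvg U A -> mxcvg V B -> mxcvg (fun k => U k - V k) (A - B).
Proof.
move=> UA VB i j; rewrite !mxE; under eq_fun do rewrite !mxE.
exact: cvgB.
Qed.

Lemma mxcvg_trace n (U : nat -> 'M[K]_n) A :
  mxcvg U A -> (fun k => \tr (U k)) @ \oo --> \tr A.
Proof.
move=> UA; apply: (@cvg_big K _ +%R 0 xpredT) => [|l _]; last exact: UA.
exact: add_continuous.
Qed.

Lemma mxcvg_unique m n (U : nat -> 'M[K]_(m, n)) A B :
  mxcvg U A -> mxcvg U B -> A = B.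
Proof.
move=> UA UB; apply/matrixP => i j.
by apply: cvg_unique (UA i j) (UB i j); exact: norm_hausdorff.
Qed.

End MatrixLimits.

(** * Averages over finite families of group elements *)

Section FrobeniusNorm.
Context {R : realType}.
Local Notation C := R[i].

Definition sqnormmx {m n} (A : 'M[C]_(m, n)) : R :=
  \sum_i \sum_j sqnormc (A i j).

Lemma sqnormmx_ge0 m n (A : 'M[C]_(m, n)) : 0 <= sqnormmx A.
Proof. by do 2!apply: sumr_ge0 => ? _; exact: sqnormc_ge0. Qed.

Lemma sqnormc_le_mx m n (A : 'M[C]_(m, n)) i j : sqnormc (A i j) <= sqnormmx A.
Proof.
rewrite /sqnormmx (bigD1 i) //= (bigD1 j) //= -addrA lerDl addr_ge0 //.
  by apply: sumr_ge0 => ? _; exact: sqnormc_ge0.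
by do 2!apply: sumr_ge0 => ? _; exact: sqnormc_ge0.
Qed.

Lemma sqnormmx_tr m n (A : 'M[C]_(m, n)) : sqnormmx A^T = sqnormmx A.
Proof.
rewrite /sqnormmx exchange_big; apply: eq_bigr => i _; apply: eq_bigr => j _.
by rewrite mxE.
Qed.

(** The parallelogram law solved for the midpoint: the term in [A - B] is the strict convexity that
    makes minimising sequences converge. *)
Lemma sqnormmx_parallelogram m n (A B : 'M[C]_(m, n)) :
  sqnormmx (2^-1 *: (A + B)) =
  (sqnormmx A + sqnormmx B) / 2 - sqnormmx (A - B) / 4.
Proof.
rewrite /sqnormmx -big_split /= !mulr_suml -sumrB; apply: eq_bigr => i _.
rewrite -big_split /= !mulr_suml -sumrB; apply: eq_bigr => j _.
rewrite !mxE sqnormcM.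
have -> : sqnormc (2^-1 : C) = 4^-1.
  have -> : (2^-1 : C) = (2^-1 : R)%:C by rewrite fmorphV rmorph_nat.
  by rewrite /sqnormc /=; field.
by case: (A i j) (B i j) => [a b] [c d]; rewrite /sqnormc /=; field.
Qed.

Lemma sqnormmxM_le m n p (A : 'M[C]_(m, n)) (M : R) :
  (forall i j, sqnormc (A i j) <= M) ->
  forall B : 'M[C]_(n, p), sqnormmx (A *m B) <= m%:R * (2 ^+ n * M) * sqnormmx B.
Proof.
move=> AM B; rewrite {1}/sqnormmx.
have H i : \sum_j sqnormc ((A *m B) i j) <= 2 ^+ n * M * sqnormmx B.
  rewrite /sqnormmx exchange_big mulr_sumr; apply: ler_sum => j _.
  rewrite mxE; apply: le_trans (sqnormc_sum_le _ _) _.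
  rewrite /index_enum -enumT size_enum_ord enumT -mulrA ler_pM2l ?exprn_gt0 //.
  rewrite mulr_sumr; apply: ler_sum => k _; rewrite sqnormcM.
  by rewrite ler_wpM2r ?sqnormc_ge0.
apply: le_trans (ler_sum _ (fun i _ => H i)) _.
by rewrite sumr_const card_ord -[leRHS]mulrA mulr_natl.
Qed.

(** In the results about abstract groups, compactness is present only through this uniform bound. *)
Definition mxbounded {T : Type} {m n} (f : T -> 'M[C]_(m, n)) : Prop :=
  exists M : R, forall g i j, sqnormc (f g i j) <= M.

Lemma mxbounded_sqnorm (T : Type) m n p q (f : T -> 'M[C]_(m, n))
    (h : T -> 'M[C]_(p, q)) : mxbounded f -> mxbounded h ->
  exists2 K : R, 0 < K &
    forall g g' B, sqnormmx (f g *m B *m h g') <= K * sqnormmx B.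
Proof.
move=> [M fM] [N hN].
pose K1 := `|m%:R * (2 ^+ n * M)|; pose K2 := `|q%:R * (2 ^+ p * N)|.
exists (K1 * K2 + 1) => [|g g' B]; first by rewrite ltr_wpDl // mulr_ge0 ?normr_ge0.
have h1 (A : 'M[C]_(n, p)) : sqnormmx (f g *m A) <= K1 * sqnormmx A.
  apply: le_trans (sqnormmxM_le (fM g) _) _.
  by rewrite ler_wpM2r ?sqnormmx_ge0 // ler_norm.
have h2 (A : 'M[C]_(m, p)) : sqnormmx (A *m h g') <= K2 * sqnormmx A.
  (* Right multiplication reduces to left multiplication by transposing. *)
  rewrite -sqnormmx_tr trmx_mul -[sqnormmx A]sqnormmx_tr.
  have hT i j : sqnormc ((h g')^T i j) <= N by rewrite mxE.
  apply: le_trans (sqnormmxM_le hT _) _.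
  by rewrite ler_wpM2r ?sqnormmx_ge0 // ler_norm.
apply: le_trans (h2 _) _; rewrite mulrDl mul1r.
apply: ler_wpDr; first exact: sqnormmx_ge0.
by rewrite [K1 * K2]mulrC -mulrA; apply: ler_wpM2l; first exact: normr_ge0.
Qed.

End FrobeniusNorm.

(** * Invariant matrices as limits of finite averages *)

Section InvariantAverage.
Context {R : realType} {G : groupType}.
Local Notation C := (R[i] : numFieldType).

Definition mxhom {n} (rho : G -> 'M[R[i]]_n) : Prop :=
  rho 1%g = 1%:M /\ forall g h, rho (g * h)%g = rho g *m rho h.

Lemma mxhom_cst n : mxhom (fun=> 1%:M : 'M[R[i]]_n).
Proof. by split=> // *; rewrite mul1mx. Qed.

Lemma mxhomVl n (rho : G -> 'M[R[i]]_n) g : mxhom rho -> rho g^-1%g *m rho g = 1%:M.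
Proof. by move=> [r1 rM]; rewrite -rM mulVg. Qed.

Lemma mxhomVr n (rho : G -> 'M[R[i]]_n) g : mxhom rho -> rho g *m rho g^-1%g = 1%:M.
Proof. by move=> [r1 rM]; rewrite -rM mulgV. Qed.

Context {n p : nat} (rho : G -> 'M[R[i]]_n) (sigma : G -> 'M[R[i]]_p).
Implicit Types (A B : 'M[R[i]]_(n, p)) (t : seq G).

(** The action of [G] on linear maps from the space of [sigma] to that of [rho]; its fixed points
    are the intertwining maps. *)
Definition twist g A := rho g *m A *m sigma g^-1%g.

Definition avg_twist t A : 'M[R[i]]_(n, p) :=
  (size t)%:R^-1 *: \sum_(g <- t) twist g A.

Hypotheses (hr : mxhom rho) (hs : mxhom sigma).
Hypotheses (br : mxbounded rho) (bs : mxbounded sigma).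

Lemma twistM g h A : twist g (twist h A) = twist (g * h)%g A.
Proof.
have [_ rM] := hr; have [_ sM] := hs.
by rewrite /twist invgM rM sM !mulmxA.
Qed.

Lemma twist1 A : twist 1%g A = A.
Proof.
have [r1 _] := hr; have [s1 _] := hs.
by rewrite /twist invg1 r1 s1 mul1mx mulmx1.
Qed.

Lemma twistD g A B : twist g (A + B) = twist g A + twist g B.
Proof. by rewrite /twist mulmxDr mulmxDl. Qed.

Lemma twistZ g c A : twist g (c *: A) = c *: twist g A.
Proof. by rewrite /twist -scalemxAr -scalemxAl. Qed.

Lemma twistB g A B : twist g (A - B) = twist g A - twist g B.
Proof. by rewrite /twist mulmxBr mulmxBl. Qed.

Lemma twist_avg h t A : twist h (avg_twist t A) = avg_twist [seq (h * g)%g | g <- t] A.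
Proof.
rewrite /avg_twist twistZ size_map big_map; congr (_ *: _).
rewrite /twist mulmx_sumr mulmx_suml; apply: eq_bigr => g _.
exact: (twistM h g A).
Qed.

(** Repeating each family as often as the other has elements gives both the same weight in the
    concatenation. *)
Lemma avg_twist_mid t t' A : t != [::] -> t' != [::] ->
  exists2 t'', t'' != [::] &
    avg_twist t'' A = 2^-1 *: (avg_twist t A + avg_twist t' A).
Proof.
move=> t0 t'0; pose t1 := [seq g | _ <- t', g <- t]; pose t2 := [seq g | _ <- t, g <- t'].
have s1 : size t1 = (size t * size t')%N by rewrite size_allpairs mulnC.
have s2 : size t2 = (size t * size t')%N by rewrite size_allpairs.
have nt : (size t)%:R != 0 :> R[i] by rewrite pnatr_eq0 size_eq0.
have nt' : (size t')%:R != 0 :> R[i] by rewrite pnatr_eq0 size_eq0.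
exists (t1 ++ t2).
  by rewrite -size_eq0 size_cat s1 s2 addn_eq0 andbb muln_eq0 !size_eq0 (negPf t0) (negPf t'0).
rewrite /avg_twist size_cat s1 s2 big_cat !big_allpairs_dep /=.
have sc I (r : seq I) (x : 'M[R[i]]_(n, p)) : \sum_(i <- r) x = x *+ size r.
  by elim: r => [|i r IH]; rewrite ?big_nil ?big_cons ?IH ?mulrS.
rewrite !sc -!(scaler_nat _ (\sum_(_ <- _) _)) !scalerDr !scalerA addnn -mul2n !natrM.
by congr (_ *: _ + _ *: _); field; rewrite ?nt ?nt'.
Qed.

(** This replaces the Haar integral. Among the averages of [A], one minimises an invariant, strictly
    convex functional [N]. A minimising sequence is Cauchy, and its translates are minimising too,
    so the limit is invariant. *)
Lemma exists_invariant_average A : exists2 B,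
  forall g, rho g *m B = B *m sigma g &
  exists2 t : nat -> seq G, forall k, t k != [::] &
    @mxcvg C _ _ (fun k => avg_twist (t k) A) B.
Proof.
have [K K0 KP] : exists2 K : R, 0 < K & forall g B, sqnormmx (twist g B) <= K * sqnormmx B.
  by have [K K0 KP] := mxbounded_sqnorm br bs; exists K => // g B; exact: KP.
pose N B := sup [set sqnormmx (twist g B) | g in setT].
have Nub B g : sqnormmx (twist g B) <= N B.
  apply: ub_le_sup; last by exists g.
  by exists (K * sqnormmx B) => _ [h _ <-].
have Nle B x : (forall g, sqnormmx (twist g B) <= x) -> N B <= x.
  move=> H; apply: ge_sup; first by exists (sqnormmx (twist 1%g B)), 1%g.
  by move=> _ [g _ <-].
have Nge0 B : 0 <= N B by apply: le_trans (Nub B 1%g); exact: sqnormmx_ge0.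
have Ntwist h B : N (twist h B) <= N B by apply: Nle => g; rewrite twistM.
have K4 : 0 < 4 * K by rewrite mulr_gt0.
(* The supremum keeps the strict convexity: for every [g] the parallelogram term is at least
   [sqnormmx (B - B') / (4 * K)], because acting by the inverse of [g] enlarges squared norms at
   most by the factor [K]. *)
have Nmid B B' : sqnormmx (B - B') <=
    4 * K * ((N B + N B') / 2 - N (2^-1 *: (B + B'))).
  suff h : N (2^-1 *: (B + B')) <= (N B + N B') / 2 - sqnormmx (B - B') / (4 * K).
    by rewrite mulrC -ler_pdivrMr // lerBrDl -lerBrDr.
  apply: Nle => g; rewrite twistZ twistD sqnormmx_parallelogram -twistB.
  apply: lerB; first by rewrite ler_pM2r ?invr_gt0 // lerD.
  rewrite ler_pdivrMr ?mulr_gt0 //.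
  have -> : sqnormmx (twist g (B - B')) / 4 * (4 * K) = K * sqnormmx (twist g (B - B')).
    by field.
  have {1}-> : B - B' = twist g^-1%g (twist g (B - B')) by rewrite twistM mulVg twist1.
  exact: KP.
pose S := [set N (avg_twist t A) | t in [set t | t != [::]]].
have Sinf : has_inf S.
  split; first by exists (N (avg_twist [:: 1%g] A)), [:: 1%g].
  by exists 0 => _ [t _ <-].
have infS t : t != [::] -> inf S <= N (avg_twist t A).
  by move=> t0; apply: ge_inf; [exact: Sinf.2|exists t].
have /choice[t tP] k : exists t, t != [::] /\ N (avg_twist t A) < inf S + k.+1%:R^-1.
  have k0 : 0 < k.+1%:R^-1 :> R by rewrite invr_gt0 ltr0n.
  by have [_ [t t0 <-] h] := inf_adherent k0 Sinf; exists t.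
(* The midpoint of two almost minimal averages is an average, so [N] is at least the infimum there;
   this forces the two to be close. *)
have close k l t' : t' != [::] -> N (avg_twist t' A) <= inf S + l.+1%:R^-1 ->
    sqnormmx (avg_twist (t k) A - avg_twist t' A) <=
    2 * K * (k.+1%:R^-1 + l.+1%:R^-1).
  move=> t'0 ht'; have [tk0 htk] := tP k.
  have [t2 t20 e2] := avg_twist_mid A tk0 t'0.
  apply: le_trans (Nmid _ _) _; rewrite -e2.
  have eK x y : 2 * K * (x + y) = 4 * K * ((x + y) / 2) by field.
  rewrite eK ler_pM2l //; move: ht' htk (infS _ t20).
  move: (N (avg_twist t2 A)) (N (avg_twist t' A)) (N (avg_twist (t k) A)) (inf S).
  move: (k.+1%:R^-1) (l.+1%:R^-1) => x y a b c e ? ? ?; lra.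
pose Bk k := avg_twist (t k) A.
have entry k l i j : sqnormc (Bk k i j - Bk l i j) <= 2 * K * (k.+1%:R^-1 + l.+1%:R^-1).
  have [tl0 htl] := tP l; have := close k l _ tl0 (ltW htl).
  by apply: le_trans; have := sqnormc_le_mx (Bk k - Bk l) i j; rewrite !mxE.
have cvgRe i j : exists x : R, (fun k => complex.Re (Bk k i j)) @ \oo --> x.
  apply: (@cauchy_cvg_of_sq _ _ (2 * K)) => k l; apply: le_trans (entry k l i j).
  by rewrite -raddfB lerDl sqr_ge0.
have cvgIm i j : exists x : R, (fun k => complex.Im (Bk k i j)) @ \oo --> x.
  apply: (@cauchy_cvg_of_sq _ _ (2 * K)) => k l; apply: le_trans (entry k l i j).
  by rewrite -raddfB lerDr sqr_ge0.
pose B : 'M[R[i]]_(n, p) := \matrix_(i, j)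
  Complex (projT1 (cid (cvgRe i j))) (projT1 (cid (cvgIm i j))).
have BkB : @mxcvg C _ _ Bk B.
  move=> i j; apply: cvg_complex; rewrite mxE /=.
    exact: (projT2 (cid (cvgRe i j))).
  exact: (projT2 (cid (cvgIm i j))).
exists B; last by exists t => // k; exact: (tP k).1.
move=> g; suff e : twist g B = B.
  by rewrite -[in RHS]e /twist -[in RHS]mulmxA mxhomVl // mulmx1.
apply/eqP; rewrite -subr_eq0; apply/eqP.
have lim1 : @mxcvg C _ _ (fun k => twist g (Bk k) - Bk k) (twist g B - B).
  exact: (mxcvgB (mxcvgM (mxcvgM (@mxcvg_cst C _ _ (rho g)) BkB)
    (@mxcvg_cst C _ _ (sigma g^-1%g))) BkB).
apply: mxcvg_unique lim1 _ => i j; rewrite mxE.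
(* The translate of [Bk k] by [g] is an average on which [N] is no larger, so [close] applies to
   it. *)
have bnd k : sqnormc ((twist g (Bk k) - Bk k) i j) <= 4 * K * harmonic k.
  have [tk0 htk] := tP k.
  have t'0 : [seq (g * h)%g | h <- t k] != [::] by rewrite -size_eq0 size_map size_eq0.
  have := close k k _ t'0; rewrite -twist_avg => /(_ (le_trans (Ntwist _ _) (ltW htk))).
  move=> /(le_trans (sqnormc_le_mx _ i j)).
  have -> : 2 * K * (k.+1%:R^-1 + k.+1%:R^-1) = 4 * K * harmonic k.
    by rewrite /harmonic /=; ring.
  by apply: le_trans; rewrite -/(Bk k) -opprB mxE sqnormcN.
have to0 (u : nat -> R) : (forall k, u k ^+ 2 <= 4 * K * harmonic k) -> u @ \oo --> 0.
  move=> uK; apply/cvgrPdist_lt => e e0.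
  have : (fun k => 4 * K * harmonic k) @ \oo --> 4 * K * 0.
    by apply: cvgMr; exact: cvg_harmonic.
  rewrite mulr0 => /cvgrPdist_lt /(_ _ (exprn_gt0 2 e0)).
  apply: filterS => k; rewrite !sub0r !normrN => /(le_lt_trans (ler_norm _)) h.
  rewrite -ltr_sqr ?nnegrE ?normr_ge0 ?ltW // real_normK ?num_real //.
  exact: le_lt_trans (uK k) h.
apply: cvg_complex; apply: to0 => k; apply: le_trans (bnd k).
  by rewrite lerDl sqr_ge0.
by rewrite lerDr sqr_ge0.
Qed.

End InvariantAverage.

(** * Trace of the inverse, Schur's lemma *)

Section Unitarity.
Context {R : realType}.
Local Notation C := R[i].

Lemma trig_mulmx_diag n (A B : 'M[C]_n) i :
  is_trig_mx A -> is_trig_mx B -> (A *m B) i i = A i i * B i i.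
Proof.
move=> /is_trig_mxP At /is_trig_mxP Bt; rewrite mxE (bigD1 i) //= big1 ?addr0 //.
move=> j; rewrite neq_ltn => /orP[ji|ij]; first by rewrite Bt ?mulr0.
by rewrite At ?mul0r.
Qed.

Lemma trig_mulmx n (A B : 'M[C]_n) :
  is_trig_mx A -> is_trig_mx B -> is_trig_mx (A *m B).
Proof.
move=> /is_trig_mxP At /is_trig_mxP Bt; apply/is_trig_mxP => i k ik.
rewrite mxE big1 // => j _; have [ij|ji] := ltnP i j; first by rewrite At ?mul0r.
by rewrite Bt ?mulr0 // (leq_ltn_trans ji ik).
Qed.

(** By Bernoulli's inequality the powers of a number above 1 are unbounded. *)
Lemma bounded_powers_le1 (y M : R) : 0 <= y -> (forall k, y ^+ k <= M) -> y <= 1.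
Proof.
move=> y0 yM; rewrite leNgt; apply/negP => y1.
have yk k : 1 + (y - 1) *+ k <= y ^+ k.
  elim: k => [|k IH]; first by rewrite mulr0n addr0 expr0.
  have : (y - 1) * (y ^+ k - 1) >= 0.
    by apply: mulr_ge0; rewrite subr_ge0; [exact: ltW|exact: exprn_ege1 (ltW y1)].
  rewrite exprS mulrS; move: IH; move: (y ^+ k) ((y - 1) *+ k) => u v; nra.
have d0 : 0 < y - 1 by rewrite subr_gt0.
pose k := (Num.truncn (M / (y - 1))).+1.
have : M / (y - 1) < k%:R by exact: truncnS_gt.
rewrite ltr_pdivrMr // mulr_natl ltNge => /negP; apply.
apply: le_trans (yM k); apply: le_trans (yk k); rewrite lerDr //.
Qed.

Lemma mulc_inv_conjc (x y : C) :
  sqnormc x <= 1 -> sqnormc y <= 1 -> x * y = 1 -> y = x^*.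
Proof.
move=> x1 y1 xy.
have e : sqnormc x = 1.
  apply/le_anti; rewrite x1 /= leNgt; apply/negP => lt.
  have := congr1 sqnormc xy; rewrite sqnormcM.
  rewrite {3}/sqnormc /= expr1n expr0n addr0.
  have := sqnormc_ge0 x; have := sqnormc_ge0 y; nra.
have xx : x * x^* = 1.
  move: e {xy x1}; case: x => a b; rewrite /sqnormc /= => e.
  by apply/eqP; rewrite eq_complex /= mulrN opprK -!expr2 e eqxx mulrN addrC mulrC subrr eqxx.
by rewrite -[LHS]mul1r -xx mulrAC xy mul1r.
Qed.

Context {G : groupType}.

(** The commuting matrices [rho x] and [rho x^-1%g] are trigonalised together. Their diagonal
    entries have bounded powers and are inverse in pairs, so they lie on the unit circle, where
    inverse and conjugate agree. *)
Lemma mxtrace_inv_conj n (rho : G -> 'M[C]_n) x :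
  mxhom rho -> mxbounded rho -> \tr (rho x^-1%g) = (\tr (rho x))^*.
Proof.
move=> hr br.
have comm : rho x *m rho x^-1%g = rho x^-1%g *m rho x by rewrite mxhomVr // mxhomVl.
have [P Pu /andP[]] := cotrigonalization2 comm.
have Punit := unitarymx_unit Pu.
rewrite /similar_to !conjumx //.
have [f fE] : exists f, forall g, f g = P *m rho g *m invmx P.
  by exists (fun g => P *m rho g *m invmx P).
have fM g h : f (g * h)%g = f g *m f h by rewrite !fE hr.2 !mulmxA mulmxKV.
have f1 : f 1%g = 1%:M by rewrite fE hr.1 mulmx1 mulmxV.
have ftr g : \tr (f g) = \tr (rho g) by rewrite fE mxtrace_mulC mulmxA mulVmx // mul1mx.
have fb : exists M : R, forall g i j, sqnormc (f g i j) <= M.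
  have [M rM] := br.
  have cP (Q : 'M[C]_n) : mxbounded (fun _ : unit => Q).
    by exists (sqnormmx Q) => _ i j; exact: sqnormc_le_mx.
  have [K K0 KP] := mxbounded_sqnorm (cP P) (cP (invmx P)).
  exists (K * \sum_(i < n) \sum_(j < n) M) => g i j.
  rewrite fE; apply: le_trans (sqnormc_le_mx _ i j) (le_trans (KP tt tt _) _).
  rewrite ler_pM2l //; apply: ler_sum => k _; apply: ler_sum => l _; exact: rM.
(* The powers of [f g i i] are diagonal entries of [f (g ^+ k)%g], hence bounded. *)
have diag_le1 g i : is_trig_mx (f g) -> sqnormc (f g i i) <= 1.
  move=> ft; have [M fMb] := fb.
  have fk k : is_trig_mx (f (g ^+ k)%g) /\ f (g ^+ k)%g i i = f g i i ^+ k.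
    elim: k => [|k [IH1 IH2]].
      rewrite expg0 f1 expr0; split; last by rewrite mxE eqxx.
      apply/is_trig_mxP => a b ab; rewrite mxE.
      by case: eqP ab => // ->; rewrite ltnn.
    rewrite expgS fM exprS -IH2; split; first exact: trig_mulmx ft IH1.
    exact: trig_mulmx_diag ft IH1.
  apply: (@bounded_powers_le1 _ M); first exact: sqnormc_ge0.
  by move=> k; rewrite -sqnormcX -(fk k).2.
rewrite -!fE => fx fVx.
rewrite -!ftr rmorph_sum; apply: eq_bigr => i _; apply: mulc_inv_conjc.
- exact: diag_le1.
- exact: diag_le1.
by rewrite -trig_mulmx_diag // -fM mulgV f1 mxE eqxx.
Qed.

End Unitarity.

(** * Schur's lemma and averages of an irreducible representation *)

Section SchurLemma.
Context {R : realType} {G : groupType}.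
Local Notation C := R[i].

Definition mxirreducible n (rho : G -> 'M[C]_n) : Prop :=
  (0 < n)%N /\ forall U : {vspace 'cV[C]_n},
    (forall g v, v \in U -> rho g *m v \in U) -> U = 0%VS \/ U = fullv.

(** Schur's lemma: for an eigenvalue [a], the kernel of [B - a%:M] is a nonzero stable subspace,
    hence everything. *)
Lemma mxirreducible_scalar n (rho : G -> 'M[C]_n) (B : 'M[C]_n) :
  mxirreducible rho -> (forall g, rho g *m B = B *m rho g) ->
  exists a, B = a%:M.
Proof.
move=> [n0 irr] comm.
(* [eigenvalue] concerns row vectors, whereas the stable subspaces consist of columns; hence the
   transpose. *)
have [a] : exists a, root (char_poly B^T) a.
  by apply/closed_rootP; rewrite size_char_poly eqSS -lt0n.
rewrite -eigenvalue_root_char => /eigenvalueP[v vB v0].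
exists a; pose f := linfun (mulmx (B - a%:M) : 'cV[C]_n -> 'cV[C]_n).
have kerE w : (w \in lker f) = (B *m w == a *: w).
  by rewrite memv_ker lfunE /= mulmxBl mul_scalar_mx subr_eq0.
have vker : v^T \in lker f by rewrite kerE -[B]trmxK -trmx_mul vB linearZ.
have [|ker0|kerT] := irr (lker f).
- move=> g w; rewrite !kerE => /eqP e.
  by rewrite mulmxA -comm -mulmxA e -scalemxAr.
- by move: vker; rewrite ker0 memv0 -(inj_eq (@trmx_inj _ _ _)) trmxK trmx0 (negPf v0).
apply/matrixP => i j.
have : delta_mx j 0 \in lker f by rewrite kerT memvf.
rewrite kerE -colE => /eqP/matrixP/(_ i 0); rewrite !mxE => ->.
by rewrite eqxx andbT mulr_natr.
Qed.

(** The line spanned by [v] is stable, hence the whole space, and the action on it is trivial. *)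
Lemma mxirreducible_no_fixed n (rho : G -> 'M[C]_n) (v : 'cV[C]_n) :
  mxhom rho -> mxirreducible rho -> (forall g, rho g *m v = v) -> v != 0 ->
  n = 1%N /\ forall g, rho g = 1%:M.
Proof.
move=> hr [n0 irr] fixv v0.
have [|U0|UT] := irr <[v]>%VS.
- by move=> g w /vlineP[c ->]; rewrite -scalemxAr fixv; apply/vlineP; exists c.
- by have := memv_line v; rewrite U0 memv0 (negPf v0).
split.
  by have := dim_vline v; rewrite UT dimvf v0 /dim /= muln1.
move=> g; apply/matrixP => i j.
have /vlineP[c cE] : delta_mx j 0 \in <[v]>%VS by rewrite UT memvf.
have := congr1 (mulmx (rho g)) cE.
by rewrite -scalemxAr fixv -cE -colE => /matrixP/(_ i 0); rewrite !mxE eqxx andbT.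
Qed.

(** The invariant limit is scalar by Schur's lemma, and its trace is that of [A] because conjugation
    preserves traces. *)
Lemma conjugates_average n (rho : G -> 'M[C]_n) (A : 'M[C]_n) :
  mxhom rho -> mxbounded rho -> mxirreducible rho ->
  exists2 t : nat -> seq G, forall k, t k != [::] &
    @mxcvg (C : numFieldType) _ _ (fun k => avg_twist rho rho (t k) A)
      ((\tr A / n%:R)%:M).
Proof.
move=> hr br irr; have [B comm [t t0 tB]] := exists_invariant_average hr hr br br A.
have [b Bb] := mxirreducible_scalar irr comm.
exists t; first exact: t0.
suff : \tr A = \tr B.
  move=> trA; have e : \tr A / n%:R = b.
    by rewrite trA Bb mxtrace_scalar -[b *+ n]mulr_natr mulfK // pnatr_eq0 -lt0n; exact: irr.1.
  by rewrite e -Bb.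
have trk k : \tr (avg_twist rho rho (t k) A) = \tr A.
  rewrite /avg_twist mxtraceZ (raddf_sum (@mxtrace _ n)) /=.
  under eq_bigr do rewrite mxtrace_mulC mulmxA mxhomVl // mul1mx.
  have cs (r : seq G) (z : C) : \sum_(i <- r) z = z *+ size r.
    by elim: r => [|i r IH]; rewrite ?big_nil ?big_cons ?IH ?mulrS.
  by rewrite cs -[\tr A *+ _]mulr_natl mulKf // pnatr_eq0 size_eq0.
have := mxcvg_trace tB; under eq_fun do rewrite trk.
move=> h; apply: cvg_unique h; first exact: norm_hausdorff.
exact: cvg_cst.
Qed.

(** A suitable limit of averages of the matrices [rho g] has fixed columns, so it vanishes. If all
    real traces exceeded [n / 2], so would their averages in the weak sense, and these could not
    tend to 0. *)
Lemma exists_small_trace n (rho : G -> 'M[C]_n) :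
  mxhom rho -> mxbounded rho -> mxirreducible rho ->
  ~ (n = 1%N /\ forall g, rho g = 1%:M) ->
  exists g, complex.Re (\tr (rho g)) <= n%:R / 2.
Proof.
move=> hr br irr nontriv.
have b1 : mxbounded (fun _ : G => 1%:M : 'M[C]_n).
  by exists (sqnormmx (1%:M : 'M[C]_n)) => _ i j; exact: sqnormc_le_mx.
(* With [sigma] trivial and the identity matrix as start, [avg_twist] is the plain average of [rho]
   over the family. *)
have [B Bfix [t t0 tB]] := exists_invariant_average hr (@mxhom_cst R G n) br b1 1%:M.
have B0 : B = 0.
  apply/matrixP => i j; rewrite [RHS]mxE; apply/eqP/negP => /negP Bij.
  apply: nontriv; apply: (mxirreducible_no_fixed (v := col j B)) => //.
    by move=> g; rewrite colE mulmxA Bfix mulmx1.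
  by apply/eqP => /matrixP/(_ i 0); rewrite !mxE; exact/eqP.
apply: contrapT => /forallNP big.
have n0 : 0 < n%:R / 2 :> R by rewrite divr_gt0 // ltr0n irr.1.
have lowk k : n%:R / 2 <= complex.Re (\tr (avg_twist rho (fun=> 1%:M) (t k) 1%:M)).
  rewrite /avg_twist mxtraceZ (raddf_sum (@mxtrace _ n)) /=.
  under eq_bigr do rewrite /twist !mulmx1.
  have sz : 0 < (size (t k))%:R :> R by rewrite ltr0n lt0n size_eq0.
  have -> : (size (t k))%:R^-1 = ((size (t k))%:R^-1)%:C :> C.
    by rewrite fmorphV rmorph_nat.
  have ReZ (r : R) (z : C) : complex.Re (r%:C * z) = r * complex.Re z.
    by case: z => a b /=; rewrite mul0r subr0.
  rewrite ReZ raddf_sum /= -ler_pdivrMl ?invr_gt0 // invrK.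
  rewrite mulrC mulr_natr {sz}.
  elim: (t k) => [|g r IH]; first by rewrite big_nil mulr0n.
  rewrite big_cons /= mulrS lerD // ltW // ltNge; exact/negP.
have lim0 : complex.Re (\tr (avg_twist rho (fun=> 1%:M) (t k) 1%:M)) @[k --> \oo]
    --> complex.Re (\tr B) by apply: cvg_Re; exact: mxcvg_trace tB.
move: lim0; rewrite B0 mxtrace0 /= => /cvgr_lt /(_ _ n0).
by move=> [N _ /(_ N (leqnn N))] /=; rewrite ltNge lowk.
Qed.

End SchurLemma.

(** * Random words in conjugates *)

Section ConjugateWords.
Context {G : groupType}.
Implicit Types (x g X Y : G) (s : seq G).

Fixpoint conj_word x (m : nat) X : Prop :=
  if m is m'.+1 then
    exists w g, conj_word x m' w /\
      (X = w * (g * x * g^-1) \/ X = w * (g * x^-1 * g^-1))%g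
  else X = 1%g.

(** A uniform choice from this list, multiplicities included, is a product of [m] independent
    uniform letters of [s]. *)
Fixpoint words s (m : nat) : seq G :=
  if m is m'.+1 then [seq (w * h)%g | w <- words s m', h <- s] else [:: 1%g].

Lemma size_words s m : size (words s m) = (size s ^ m)%N.
Proof. by elim: m => [|m IH] //=; rewrite size_allpairs IH expnSr. Qed.

Lemma conj_wordP x s m X :
  (forall h, h \in s -> exists g, h = (g * x * g^-1)%g \/ h = (g * x^-1 * g^-1)%g) ->
  X \in words s m -> conj_word x m X.
Proof.
move=> sx; elim: m X => [|m IH] X /=; first by rewrite inE => /eqP.
move=> /allpairsP[[w h] /= [/IH ww hs ->]]; have [g gh] := sx _ hs.
by exists w, g; split=> //; case: gh => ->; [left|right].
Qed.

Context {R : realType}.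
Local Notation C := R[i].

Definition mxpow n (A : 'M[C]_n) (k : nat) := iter k (mulmx A) 1%:M.

Lemma mxpowSr n (A : 'M[C]_n) k : mxpow A k.+1 = mxpow A k *m A.
Proof.
elim: k => [|k IH]; first by rewrite /mxpow /= mulmx1 mul1mx.
by rewrite -[mxpow A k.+2]/(A *m mxpow A k.+1) {1}IH mulmxA.
Qed.

Lemma mxpow_scalar n (a : C) k : mxpow (a%:M : 'M[C]_n) k = (a ^+ k)%:M.
Proof.
by elim: k => [|k IH] //=; rewrite -/(mxpow _ k) IH exprS scalar_mxM.
Qed.

Lemma mxpowZ n (a : C) (A : 'M[C]_n) k : mxpow (a *: A) k = a ^+ k *: mxpow A k.
Proof.
elim: k => [|k IH] /=; first by rewrite /mxpow /= expr0 scale1r.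
by rewrite -!/(mxpow _ k) IH exprS -scalemxAl -scalemxAr scalerA.
Qed.

Lemma mxcvg_pow n (U : nat -> 'M[C]_n) A k :
  @mxcvg (C : numFieldType) _ _ U A ->
  @mxcvg (C : numFieldType) _ _ (fun j => mxpow (U j) k) (mxpow A k).
Proof.
move=> UA; elim: k => [|k IH]; first exact: (@mxcvg_cst (C : numFieldType) _ _ 1%:M).
exact: (mxcvgM UA IH).
Qed.

Lemma sum_words n (rho : G -> 'M[C]_n) s m : mxhom rho ->
  \sum_(w <- words s m) rho w = mxpow (\sum_(h <- s) rho h) m.
Proof.
move=> hr; elim: m => [|m IH]; first by rewrite /= big_seq1 hr.1.
rewrite mxpowSr -IH [words s m.+1]/= big_allpairs_dep /= mulmx_suml.
apply: eq_bigr => w _; rewrite mulmx_sumr; apply: eq_bigr => h _; exact: hr.2.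
Qed.

(** Inversion reverses the order of the letters, which is invisible in a power of a single
    matrix. *)
Lemma sum_words_inv n (rho : G -> 'M[C]_n) s m : mxhom rho ->
  \sum_(w <- words s m) rho w^-1%g = mxpow (\sum_(h <- s) rho h^-1%g) m.
Proof.
move=> hr; elim: m => [|m IH] /=; first by rewrite big_seq1 invg1 hr.1.
rewrite -/(mxpow _ m) -IH big_allpairs_dep /= exchange_big /= mulmx_suml.
apply: eq_bigr => h _; rewrite mulmx_sumr; apply: eq_bigr => w _.
by rewrite invgM hr.2.
Qed.

(** Cauchy-Schwarz, from the nonnegativity of the variance of [a]. *)
Lemma sum_sq_ge (T : finType) (a : T -> R) :
  (\sum_c a c) ^+ 2 <= #|T|%:R * \sum_c a c ^+ 2.
Proof.
have [T0|T0] := posnP #|T|.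
  by rewrite !big_pred0 ?expr0n ?mulr0 // => c; have := card0_eq T0 c; rewrite !inE.
have N0 : 0 < #|T|%:R :> R by rewrite ltr0n.
set S := \sum_c a c; set Q := \sum_c _.
have : 0 <= \sum_c (#|T|%:R * a c - S) ^+ 2 by apply: sumr_ge0 => c _; exact: sqr_ge0.
have -> : \sum_c (#|T|%:R * a c - S) ^+ 2 = #|T|%:R * (#|T|%:R * Q - S ^+ 2).
  transitivity (\sum_c (#|T|%:R ^+ 2 * a c ^+ 2 - (2 * #|T|%:R * S) * a c + S ^+ 2)).
    by apply: eq_bigr => c _; ring.
  rewrite big_split sumrB /= -!mulr_sumr -/S -/Q sumr_const cardT -cardE -mulr_natl.
  ring.
by rewrite pmulr_rge0 // subr_ge0.
Qed.

(** The double sum counts colliding pairs, so it is the sum of the squares of the cell sizes. *)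
Lemma pigeonhole_pairs (T : finType) (kappa : G -> T) (W : seq G) :
  (size W)%:R ^+ 2 <= #|T|%:R *
    \sum_(X <- W) \sum_(Y <- W) (kappa X == kappa Y)%:R :> R.
Proof.
pose a c : R := \sum_(X <- W) (kappa X == c)%:R.
have aS : \sum_c a c = (size W)%:R.
  rewrite exchange_big /=; transitivity (\sum_(X <- W) (1 : R)).
    apply: eq_bigr => X _; rewrite (bigD1 (kappa X)) //= eqxx big1 ?addr0 //.
    by move=> c; rewrite eq_sym => /negPf ->.
  by elim: W {a} => [|X W IH]; rewrite ?big_nil ?big_cons ?IH -?natr1 1?addrC.
rewrite -aS; apply: le_trans (sum_sq_ge _) _; rewrite ler_wpM2l //.
rewrite le_eqVlt; apply/orP; left; apply/eqP.
transitivity (\sum_c \sum_(X <- W) \sum_(Y <- W) ((kappa X == c)%:R * (kappa Y == c)%:R : R)).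
  by apply: eq_bigr => c _; rewrite expr2 mulr_suml; apply: eq_bigr => X _; rewrite mulr_sumr.
rewrite exchange_big /=; apply: eq_bigr => X _; rewrite exchange_big /=.
apply: eq_bigr => Y _; rewrite (bigD1 (kappa X)) //= eqxx mul1r eq_sym big1 ?addr0 //.
by move=> c; rewrite eq_sym => /negPf ->; rewrite mul0r.
Qed.

(** The mean of the real trace at [X^-1 * Y] is estimated twice. With [e = 1 / (4 * #|T|)] and all
    real traces above [- e * n], collisions make it at least [2 * e * n - e * n]. In the limit it is
    [a ^ (2 * m) * n], at most [n / 4 ^ m], which is less than [e * n]. *)
Lemma exists_negative_of_words n (rho : G -> 'M[C]_n) (T : finType)
    (kappa : G -> T) (x : G) (m : nat) :
  mxhom rho -> mxbounded rho -> mxirreducible rho ->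
  complex.Re (\tr (rho x)) <= n%:R / 2 ->
  (forall X Y, conj_word x m X -> conj_word x m Y -> kappa X = kappa Y ->
     n%:R / 2 <= complex.Re (\tr (rho (X^-1 * Y)%g))) ->
  (4 * #|T| < 4 ^ m)%N ->
  exists g, complex.Re (\tr (rho g)) <= - ((4 * #|T|)%:R^-1 * n%:R).
Proof.
move=> hr br irr hx hk hm; apply: contrapT => /forallNP neg.
have n0 : 0 < n%:R :> R by rewrite ltr0n; exact: irr.1.
have T0 : (0 < #|T|)%N by apply/card_gt0P; exists (kappa 1%g).
have N0 : 0 < #|T|%:R :> R by rewrite ltr0n.
pose e : R := (4 * #|T|)%:R^-1.
have eE : e * (4 * #|T|%:R) = 1 by rewrite /e natrM mulVf // mulf_neq0 ?gt_eqF.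
have e0 : 0 < e by rewrite invr_gt0 ltr0n muln_gt0.
have {}neg g : - (e * n%:R) <= complex.Re (\tr (rho g)).
  by apply: ltW; rewrite ltNge; apply/negP; exact: neg.
pose a : R := complex.Re (\tr (rho x)) / n%:R.
(* Symmetrising makes the trace real, so the limiting scalar is [a]. *)
pose A := 2^-1 *: (rho x + rho x^-1%g).
have trA : \tr A / n%:R = a%:C.
  rewrite mxtraceZ mxtraceD mxtrace_inv_conj // addcJ mulKf ?pnatr_eq0 //.
  by rewrite /a rmorphM fmorphV rmorph_nat.
have [t t0 tA] := conjugates_average A hr br irr.
rewrite trA in tA.
(* This list of letters is closed under inversion with multiplicities, so [X^-1] and [Y] contribute
   the same matrix power. *)
pose s k := [seq (g * x * g^-1)%g | g <- t k] ++ [seq (g * x^-1 * g^-1)%g | g <- t k].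
have ss k : size (s k) = (2 * size (t k))%N by rewrite size_cat !size_map mul2n addnn.
have sinv k : \sum_(h <- s k) rho h^-1%g = \sum_(h <- s k) rho h.
  rewrite !big_cat /= addrC !big_map; congr (_ + _); apply: eq_bigr => g _;
    by rewrite !invgM !invgK mulgA.
have savg k : avg_twist rho rho (t k) A = (size (s k))%:R^-1 *: \sum_(h <- s k) rho h.
  rewrite /avg_twist ss big_cat !big_map /= -big_split /= natrM invfM mulrC -scalerA.
  congr (_ *: _); rewrite scaler_sumr; apply: eq_bigr => g _.
  by rewrite /twist -scalemxAr -scalemxAl mulmxDr mulmxDl !hr.2.
have spos k : 0 < (size (s k))%:R :> R.
  by rewrite ltr0n ss muln_gt0 /= lt0n size_eq0.
have sums k : \sum_(X <- words (s k) m) \sum_(Y <- words (s k) m) rho (X^-1 * Y)%g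
    = mxpow (\sum_(h <- s k) rho h) m *m mxpow (\sum_(h <- s k) rho h) m.
  rewrite -{1}sinv -sum_words_inv // -sum_words // mulmx_suml.
  apply: eq_bigr => X _; rewrite mulmx_sumr; apply: eq_bigr => Y _; exact: hr.2.
have bound k : e * n%:R <= complex.Re (\tr (mxpow (avg_twist rho rho (t k) A) m *m
    mxpow (avg_twist rho rho (t k) A) m)).
  set W := words (s k) m.
  have WE : (size W)%:R = (size (s k))%:R ^+ m :> R by rewrite /W size_words natrX.
  have Wpos : 0 < (size W)%:R ^+ 2 :> R by rewrite WE !exprn_gt0.
  have -> : \tr (mxpow (avg_twist rho rho (t k) A) m *m
      mxpow (avg_twist rho rho (t k) A) m) =
      ((size W)%:R ^- 2)%:C * \sum_(X <- W) \sum_(Y <- W) \tr (rho (X^-1 * Y)%g).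
    rewrite savg mxpowZ -scalemxAl -scalemxAr scalerA -sums mxtraceZ.
    rewrite (raddf_sum (@mxtrace _ n)) /=; congr (_ * _).
      by rewrite WE fmorphV !rmorphXn rmorph_nat /= expr2 exprVn invfM.
    by apply: eq_bigr => X _; rewrite (raddf_sum (@mxtrace _ n)).
  have ReZ (r : R) (z : C) : complex.Re (r%:C * z) = r * complex.Re z.
    by case: z => u v /=; rewrite mul0r subr0.
  rewrite ReZ -ler_pdivrMl ?invr_gt0 // invrK raddf_sum.
  (* A colliding pair contributes at least [n / 2], any other at least [- (e * n)]; subtracting
     [e * n] throughout gives a bound that sums easily. *)
  have low : \sum_(X <- W) \sum_(Y <- W)
      ((n%:R / 2) * (kappa X == kappa Y)%:R - e * n%:R) <=
      \sum_(X <- W) complex.Re (\sum_(Y <- W) \tr (rho (X^-1 * Y)%g)).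
    rewrite big_seq [leRHS]big_seq; apply: ler_sum => X XW.
    rewrite raddf_sum big_seq [leRHS]big_seq; apply: ler_sum => Y YW.
    have sP h : h \in s k -> exists g, h = (g * x * g^-1)%g \/ h = (g * x^-1 * g^-1)%g.
      by rewrite mem_cat => /orP[] /mapP[g _ ->]; exists g; [left|right].
    case: eqP => [eXY|_]; last by rewrite mulr0 sub0r neg.
    have := hk _ _ (conj_wordP sP XW) (conj_wordP sP YW) eXY.
    rewrite mulr1; apply: le_trans; rewrite gerBl mulr_ge0 ?ltW //.
  apply: le_trans low.
  have -> : \sum_(X <- W) \sum_(Y <- W)
      ((n%:R / 2) * (kappa X == kappa Y)%:R - e * n%:R) =
      (n%:R / 2) * \sum_(X <- W) \sum_(Y <- W) (kappa X == kappa Y)%:R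
      - (size W)%:R ^+ 2 * (e * n%:R).
    have cs (r : seq G) (z : R) : \sum_(i <- r) z = (size r)%:R * z.
      by elim: r => [|i r IH]; rewrite ?big_nil ?big_cons ?mul0r //= IH -natr1; ring.
    under eq_bigr do rewrite sumrB cs -mulr_sumr.
    by rewrite sumrB cs -mulr_sumr mulrA expr2.
  have := pigeonhole_pairs kappa W; set P := (\sum_(X <- W) _); set V := (size W)%:R ^+ 2.
  move=> VP; rewrite lerBrDr -mulrDr.
  have -> : n%:R / 2 * P = (n%:R * e * 2) * (#|T|%:R * P).
    transitivity (n%:R / 2 * P * (e * (4 * #|T|%:R))); first by rewrite eE mulr1.
    by field.
  have -> : V * (e * n%:R + e * n%:R) = (n%:R * e * 2) * V by ring.
  by rewrite ler_wpM2l // !mulr_ge0 ?ltW.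
have tAm := mxcvg_pow (k := m) tA.
have lim := mxcvg_trace (mxcvgM tAm tAm).
have limRe : complex.Re (\tr (mxpow (avg_twist rho rho (t k) A) m *m
      mxpow (avg_twist rho rho (t k) A) m)) @[k --> \oo] -->
    complex.Re (\tr (mxpow (a%:C)%:M m *m mxpow ((a%:C)%:M : 'M[C]_n) m)).
  by apply: cvg_Re; exact: lim.
move: limRe; rewrite !mxpow_scalar -scalar_mxM mxtrace_scalar -exprD.
have -> : complex.Re (a%:C ^+ (m + m) *+ n) = a ^+ (m + m) * n%:R.
  by rewrite -rmorphXn -mulr_natr -(rmorph_nat (real_complex R)) -rmorphM.
suff small : a ^+ (m + m) * n%:R < e * n%:R.
  move=> /cvgr_lt /(_ _ small) [K _ /(_ K (leqnn K))] /=.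
  by rewrite ltNge bound.
rewrite ltr_pM2r // addnn -mul2n exprM.
have a2 : a ^+ 2 <= 4^-1.
  have ha : a <= 2^-1 by rewrite /a ler_pdivrMr // mulrC.
  (* The assumed lower bound on traces is used at [x]: as [e] is at most 1/2, [a] is at least
     -1/2. *)
  have hna : - 2^-1 <= a.
    rewrite /a ler_pdivlMr //; apply: le_trans (neg x); rewrite mulNr lerN2.
    rewrite ler_pM2r //; rewrite /e lef_pV2 ?posrE ?ltr0n ?muln_gt0 //.
    by rewrite ler_nat (@leq_trans 4) // leq_pmulr.
  by nra.
apply: (@le_lt_trans _ _ (4^-1 ^+ m)); first by rewrite lerXn2r ?nnegrE ?sqr_ge0 ?invr_ge0.
rewrite /e exprVn ltf_pV2 ?posrE ?exprn_gt0 ?ltr0n ?muln_gt0 //.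
by rewrite -natrX ltr_nat.
Qed.

End ConjugateWords.

(** * Local Lipschitz estimates *)

Section LocalLipschitz.
Context {R : realType}.

Lemma rV_norm_le d (x : 'rV[R]_d) (K : R) :
  0 <= K -> (forall j, `|x 0 j| <= K) -> `|x| <= K.
Proof.
move=> K0 xK; rewrite [leLHS]mx_normrE; apply: bigmax_le => // -[i j] _ /=.
by rewrite (ord1 i).
Qed.

Lemma rV_coord_le d (x : 'rV[R]_d) j : `|x 0 j| <= `|x|.
Proof. by rewrite [leRHS]mx_normrE; exact: (le_bigmax _ _ (0, j)). Qed.

(** Stated abstractly so that one Lipschitz lemma serves both the model space and its square, on
    which multiplication is read. *)
Definition bounded_coordinates (V : normedModType R) : Prop :=
  exists (I : finType) (e : I -> V) (c : I -> V -> R),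
    (forall v, v = \sum_i c i v *: e i) /\ forall i v, `|c i v| <= `|v|.

Lemma rV_bounded_coordinates d : bounded_coordinates 'rV[R]_d.
Proof.
exists 'I_d, (fun i => delta_mx 0 i), (fun i (v : 'rV[R]_d) => v 0 i); split.
  by move=> v; exact: row_sum_delta.
by move=> i v; exact: rV_coord_le.
Qed.

Lemma prod_bounded_coordinates (V W : normedModType R) :
  bounded_coordinates V -> bounded_coordinates W ->
  bounded_coordinates (V * W)%type.
Proof.
move=> [I [e [c [ce cb]]]] [J [f [b [bf bb]]]].
exists (I + J)%type, (fun k => match k with inl i => (e i, 0) | inr j => (0, f j) end),
  (fun k v => match k with inl i => c i v.1 | inr j => b j v.2 end); split.
  move=> [v w]; rewrite big_sumType /=.
  have inl_sum (r : seq I) :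
      (\sum_(i <- r) c i v *: e i, 0) = \sum_(i <- r) c i v *: (e i, 0) :> V * W.
    elim: r => [|i r IH]; rewrite ?big_nil // !big_cons -IH.
    by apply/eqP; rewrite xpair_eqE /= scaler0 addr0 !eqxx.
  have inr_sum (r : seq J) :
      (0, \sum_(i <- r) b i w *: f i) = \sum_(i <- r) b i w *: (0, f i) :> V * W.
    elim: r => [|i r IH]; rewrite ?big_nil // !big_cons -IH.
    by apply/eqP; rewrite xpair_eqE /= scaler0 addr0 !eqxx.
  rewrite -inl_sum -inr_sum -ce -bf.
  by apply/eqP; rewrite xpair_eqE /= addr0 add0r !eqxx.
move=> [i|j] v; rewrite prod_normE le_max.
  by rewrite cb.
by rewrite bb orbT.
Qed.

Lemma derive_along_line (V W : normedModType R) (f : V -> W) (b v : V) (t : R) :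
  derivable f (b + t *: v) v ->
  derivable (fun s : R => f (b + s *: v)) t 1 /\
  'D_1 (fun s : R => f (b + s *: v)) t = 'D_v f (b + t *: v).
Proof.
have e : (fun h : R => h^-1 *: (f (b + (h *: (1 : R) + t) *: v) - f (b + t *: v))) =
         (fun h : R => h^-1 *: (f (h *: v + (b + t *: v)) - f (b + t *: v))).
  apply/funext => h; congr (_ *: (f _ - _)).
  by rewrite [h *: 1]mulr1 scalerDl addrCA.
by rewrite /derivable /derive /= -e.
Qed.

(** The derivatives along the finite family [e] are continuous, hence bounded near [p]; the mean
    value theorem on segments of a ball is applied to each coordinate of [f]. *)
Lemma smooth_local_lipschitz (V : normedModType R) d (U : set V)
    (f : V -> 'rV[R]_d) (p : V) :
  bounded_coordinates V -> open U -> U p -> smooth_on U f ->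
  exists r L, [/\ 0 < r, 0 < L, forall a, `|p - a| < r -> U a &
    forall a b, `|p - a| < r -> `|p - b| < r -> `|f a - f b| <= L * `|a - b|].
Proof.
move=> [I [e [c [ce cb]]]] Uo Up /(_ 1%N) /= [df Df].
pose M i := `|'D_(e i) f p| + 1.
have : \forall x \near p, U x /\ forall i, `|'D_(e i) f x| <= M i.
  near=> x; split.
    by near: x; exact: open_nbhs_nbhs.
  near: x; apply: filter_forall => i.
  have /cvg_norm := Df (e i) p Up; move=> /cvgr_le; apply.
  by rewrite ltrDl.
(* The summand 1 keeps [L] positive even when the family is empty. *)
move=> /nbhs_normP[r /= r0 rP]; pose L := \sum_i M i + 1.
have M0 i : 0 <= M i by rewrite addr_ge0.
have L0 : 0 < L by rewrite ltr_wpDl // sumr_ge0.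
exists r, L; split => //.
  by move=> a /rP[].
move=> a b pa pb; apply: rV_norm_le; first by rewrite mulr_ge0 // ltW.
move=> j; pose v := a - b.
have seg t : 0 <= t <= 1 -> `|p - (b + t *: v)| < r.
  move=> /andP[t0 t1].
  have -> : p - (b + t *: v) = (1 - t) *: (p - b) + t *: (p - a).
    rewrite scalerBl scale1r -addrA -scalerN -scalerDr opprB addrA subrK.
    by rewrite -[b - a]opprB scalerN -/v opprD addrA.
  apply: le_lt_trans (ler_normD _ _) _; rewrite !normrZ (ger0_norm t0) ger0_norm ?subr_ge0 //.
  have [->|tn1] := eqVneq t 1; first by rewrite subrr mul0r add0r mul1r.
  have t1' : 0 < 1 - t by rewrite subr_gt0 lt_neqAle tn1.
  apply: (@lt_le_trans _ _ ((1 - t) * r + t * r)); last by rewrite -mulrDl subrK mul1r.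
  by rewrite ltr_leD ?ltr_pM2l // ler_wpM2l // ltW.
have Dv x : `|p - x| < r -> `|'D_v f x| <= L * `|v|.
  move=> /rP[Ux Mx]; have dfx := df x Ux.
  rewrite deriveE // {1}[v]ce linear_sum; apply: le_trans (ler_norm_sum _ _ _) _.
  rewrite /L mulrDl mulr_suml mul1r; apply: ler_wpDr => //.
  apply: ler_sum => i _; rewrite linearZ /= normrZ mulrC ler_pM //.
  by rewrite -deriveE.
pose phi (s : R) := f (b + s *: v) 0 j.
have derphi t : 0 <= t <= 1 -> derivable phi t 1 /\ 'D_1 phi t = ('D_v f (b + t *: v)) 0 j.
  move=> /seg/rP[Ux _].
  have [d1 d2] := derive_along_line (diff_derivable (v := v) (df _ Ux)).
  split; first by move/derivable_mxP : d1; exact.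
  by rewrite -d2 derive_mx // mxE.
have [|||t] := @MVT_segment R phi (fun t => 'D_1 phi t) 0 1.
- exact: ler01.
- move=> t; rewrite in_itv /= => /andP[t0 t1]; apply: derivableP.
  by apply: (derphi t _).1; rewrite !ltW.
- apply: derivable_within_continuous => t; rewrite in_itv /= => t01.
  exact: (derphi t t01).1.
rewrite in_itv /= => t01; rewrite subr0 mulr1 /phi scale1r scale0r addr0 subrKC => e01.
rewrite !mxE e01 (derphi t t01).2; apply: le_trans (rV_coord_le _ _) _.
exact: Dv (seg t t01).
Unshelve. all: by end_near. Qed.

End LocalLipschitz.

Section ChartLipschitz.
Context {R : realType}.

Lemma chart_local_lipschitz (E : normedModType R) d (T T' : topologicalType)
    (c : chart E T) (c' : chart 'rV[R]_d T') (F : T -> T') (x : T) :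
  bounded_coordinates E -> is_chart c -> is_chart c' -> continuous F ->
  smooth_on (chart_cod c `&` (F \o chart_inv c) @^-1` chart_dom c')
            (c' \o F \o chart_inv c) ->
  chart_dom c x -> chart_dom c' (F x) ->
  exists r L, [/\ 0 < r, 0 < L & forall y z, chart_dom c y -> chart_dom c z ->
    `|c x - c y| < r -> `|c x - c z| < r ->
    chart_dom c' (F y) /\ `|c' (F y) - c' (F z)| <= L * `|c y - c z|].
Proof.
move=> hE [[domo codo] [cdom ccod] [cK invK] [_ invc]] [[domo' _] _ _ _] Fc sm xc Fxc'.
have Uo : open (chart_cod c `&` (F \o chart_inv c) @^-1` chart_dom c').
  rewrite openE => a [ac /= aF]; apply: filterI; first exact: open_nbhs_nbhs.
  have h := continuous_comp (invc a ac) (Fc (chart_inv c a)).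
  by apply: h; apply: open_nbhs_nbhs.
have [|r [L [r0 L0 rU rL]]] := smooth_local_lipschitz hE Uo _ sm (p := c x).
  by split; [exact: cdom|rewrite /= cK].
exists r, L; split => // y z yc zc yr zr; split.
  by have [_ /=] := rU _ yr; rewrite cK.
by have := rL _ _ yr zr; rewrite /= !cK.
Qed.

Lemma continuous_prod_map (A B A' B' : topologicalType) (f : A -> A') (g : B -> B')
    (a : A) (b : B) : {for a, continuous f} -> {for b, continuous g} ->
  {for (a, b), continuous (fun p : A * B => (f p.1, g p.2))}.
Proof.
move=> fa gb W [[U V] [/= Ua Vb] UVW].
exists (f @^-1` U, g @^-1` V); first by split; [exact: fa|exact: gb].
by move=> [x y] [/= xU yV]; apply: UVW.
Qed.

Lemma prod_is_chart (E E' : normedModType R) (T T' : topologicalType)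
    (c : chart E T) (c' : chart E' T') :
  is_chart c -> is_chart c' -> is_chart (prod_chart c c').
Proof.
move=> [[d1 d2] [m1 m2] [k1 k2] [c1 c2]] [[d1' d2'] [m1' m2'] [k1' k2'] [c1' c2']].
have openX (A B : topologicalType) (U : set A) (V : set B) :
    open U -> open V -> open (U `*` V).
  move=> Uo Vo; rewrite openE => -[a b] [/= aU bV]; exists (U, V) => //=.
  by split; exact: open_nbhs_nbhs.
split=> /=.
- by split; exact: openX.
- by split=> -[a b] [/= ha hb]; split=> /=; auto.
- by split=> -[a b] [/= ha hb]; [rewrite k1 // k1'|rewrite k2 // k2'].
split=> -[a b] [/= ha hb].
  by apply: continuous_prod_map; [exact: c1|exact: c1'].
by apply: continuous_prod_map; [exact: c2|exact: c2'].
Qed.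

End ChartLipschitz.

(** * Group operations in a chart at the identity *)

Section LieGroupCharts.
Context {R : realType} {d : nat} {G : lieGroupType R d}.
Local Notation atlas := (@lie_atlas R d G).
Implicit Types (x y z g h : G) (c : chart 'rV[R]_d G).

Lemma lie_is_chart c : atlas c -> is_chart c.
Proof. by move: c; have [] := @lie_smooth_atlas R d G. Qed.

Lemma lie_chart_at x : exists2 c, atlas c & chart_dom c x.
Proof. by have [_ h _] := @lie_smooth_atlas R d G; exact: h. Qed.

Lemma lie_mul_continuous : continuous (fun p : G * G => (p.1 * p.2)%g).
Proof. exact: (@lie_mul_smooth R d G).1. Qed.

Lemma lie_inv_continuous : continuous (fun x => x^-1%g).
Proof. exact: (@lie_inv_smooth R d G).1. Qed.

Lemma lie_mul_lipschitz g h c1 c2 c3 :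
  atlas c1 -> atlas c2 -> atlas c3 ->
  chart_dom c1 g -> chart_dom c2 h -> chart_dom c3 (g * h)%g ->
  exists r L, [/\ 0 < r, 0 < L & forall y y' z z',
    chart_dom c1 y -> chart_dom c2 y' -> chart_dom c1 z -> chart_dom c2 z' ->
    `|c1 g - c1 y| < r -> `|c2 h - c2 y'| < r ->
    `|c1 g - c1 z| < r -> `|c2 h - c2 z'| < r ->
    chart_dom c3 (y * y')%g /\
    `|c3 (y * y')%g - c3 (z * z')%g| <=
      L * Num.max `|c1 y - c1 z| `|c2 y' - c2 z'| ].
Proof.
move=> A1 A2 A3 g1 h2 gh3.
have [|r [L [r0 L0 H]]] := @chart_local_lipschitz _ _ _ (G * G)%type G
  (prod_chart c1 c2) c3 (fun p => (p.1 * p.2)%g) (g, h)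
  (prod_bounded_coordinates (rV_bounded_coordinates d) (rV_bounded_coordinates d))
  (prod_is_chart (lie_is_chart A1) (lie_is_chart A2)) (lie_is_chart A3)
  lie_mul_continuous _ (conj g1 h2) gh3.
  by apply: (@lie_mul_smooth R d G).2 => //; exists c1, c2.
exists r, L; split=> // y y' z z' y1 y2 z1 z2 ry ry' rz rz'.
have := H (y, y') (z, z') (conj y1 y2) (conj z1 z2).
by rewrite !prod_normE /= !gt_max; apply; apply/andP.
Qed.

Lemma lie_inv_lipschitz g c1 c2 :
  atlas c1 -> atlas c2 -> chart_dom c1 g -> chart_dom c2 g^-1%g ->
  exists r L, [/\ 0 < r, 0 < L & forall y z,
    chart_dom c1 y -> chart_dom c1 z -> `|c1 g - c1 y| < r -> `|c1 g - c1 z| < r ->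
    chart_dom c2 y^-1%g /\ `|c2 y^-1%g - c2 z^-1%g| <= L * `|c1 y - c1 z| ].
Proof.
move=> A1 A2 g1 g2.
apply: (chart_local_lipschitz (F := fun x : G => x^-1%g) (rV_bounded_coordinates d)
  (lie_is_chart A1) (lie_is_chart A2) lie_inv_continuous _ g1 g2).
exact: (@lie_inv_smooth R d G).2.
Qed.

Lemma near_chart c g (e : R) : atlas c -> chart_dom c g -> 0 < e ->
  \forall x \near g, chart_dom c x /\ `|c g - c x| < e.
Proof.
move=> /lie_is_chart [[dop _] _ _ [cc _]] gc e0; apply: filterI.
  exact: open_nbhs_nbhs.
by have /cvgrPdist_lt := cc g gc; exact.
Qed.

Context (c : chart 'rV[R]_d G) (cA : atlas c) (c1 : chart_dom c 1%g).

Definition chart_ball (r : R) : set G := [set x | chart_dom c x /\ `|c 1%g - c x| < r].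

Lemma chart_ball_nbhs r : 0 < r -> nbhs (1%g : G) (chart_ball r).
Proof. exact: near_chart. Qed.

Lemma chart_ballW r s : r <= s -> chart_ball r `<=` chart_ball s.
Proof. by move=> rs x [xc xr]; split=> //; exact: lt_le_trans rs. Qed.

(** For [g] near a fixed [g0], conjugation is a composite of two multiplications that are Lipschitz
    in charts, compared at [x] and at 1. Compactness gives uniformity; a single integer [k] encodes
    both the radius [1 / k.+1] and the constant [k.+1]. *)
Lemma conj_estimate : compact [set: G] -> exists r L, [/\ 0 < r, 0 < L &
  forall g x, chart_ball r x -> chart_dom c (g * x * g^-1)%g /\
    `|c 1%g - c (g * x * g^-1)%g| <= L * `|c 1%g - c x|].
Proof.
move=> /compact_near_coveringP /(_ nat \oo (fun k g => forall x,
  chart_ball k.+1%:R^-1 x -> chart_dom c (g * x * g^-1)%g /\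
    `|c 1%g - c (g * x * g^-1)%g| <= k.+1%:R * `|c 1%g - c x|)) H.
suff : \forall k \near \oo, [set: G] `<=` (fun g => forall x,
    chart_ball k.+1%:R^-1 x -> chart_dom c (g * x * g^-1)%g /\
    `|c 1%g - c (g * x * g^-1)%g| <= k.+1%:R * `|c 1%g - c x|).
  move=> [N _ /(_ N (leqnn N)) /= HN].
  by exists N.+1%:R^-1, N.+1%:R; split=> // g x; exact: HN.
apply: H => g0 _.
have [c2 A2 g2] := lie_chart_at g0; have [c3 A3 g3] := lie_chart_at g0^-1%g.
have [|r1 [L1 [r10 L10 H1]]] := lie_mul_lipschitz A2 cA A2 g2 c1; first by rewrite mulg1.
have [|r2 [L2 [r20 L20 H2]]] := lie_mul_lipschitz A2 A3 cA g2 g3; first by rewrite mulgV.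
(* The second term keeps [g * x] within [r2 / 2] of [g] in the chart [c2]; with [g] within [r2 / 2]
   of [g0], the estimate [H2] applies at [g * x]. *)
pose s := Num.min r1 (r2 / 2 / L1).
have s0 : 0 < s by rewrite lt_min r10 !divr_gt0.
exists ([set g | (chart_dom c2 g /\ `|c2 g0 - c2 g| < Num.min r1 (r2 / 2)) /\
   (chart_dom c3 g^-1%g /\ `|c3 g0^-1%g - c3 g^-1%g| < r2)],
  [set k | k.+1%:R^-1 < s /\ L2 * L1 <= k.+1%:R]).
  split; first apply: filterI.
  - by apply: near_chart => //; rewrite lt_min r10 divr_gt0.
  - exact: (lie_inv_continuous (near_chart A3 g3 r20)).
  rewrite /=; near=> k; split.
    near: k; have /cvgrPdist_lt /(_ s s0) := @cvg_harmonic R.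
    apply: filterS => k; rewrite sub0r normrN ger0_norm // invr_ge0 ler0n //.
  apply: ltW; apply: (@lt_le_trans _ _ (Num.truncn (L2 * L1)).+1%:R); first exact: truncnS_gt.
  rewrite ler_nat ltnS; near: k; exact: nbhs_infty_ge.
move=> [g k] /= [[[gd]]]; rewrite lt_min => /andP[gr1 gr2] [gvd gv] [ks kL] x [xc xk].
have {ks}xs : `|c 1%g - c x| < s by exact: lt_trans ks.
move: xs; rewrite lt_min => /andP[xr1 xr2].
have c11 : `|c 1%g - c 1%g| < r1 by rewrite subrr normr0.
have [gxd gxle] := H1 g x g 1%g gd xc gd c1 gr1 xr1 gr1 c11.
move: gxle; rewrite mulg1 subrr normr0 [Num.max _ _]max_r ?normr_ge0 // => gxle.
have gxg0 : `|c2 g0 - c2 (g * x)%g| < r2.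
  rewrite -(subrKA (c2 g)) [ltRHS]splitr; apply: le_lt_trans (ler_normD _ _) _.
  rewrite ltrD // distrC; apply: le_lt_trans gxle _.
  by rewrite mulrC -ltr_pdivlMr // distrC.
have [|gxgd gxgle] := H2 (g * x)%g g^-1%g g g^-1%g gxd gvd gd gvd gxg0 gv _ gv.
  by apply: lt_trans gr2 _; rewrite ltr_pdivrMr // ltr_pMr // ltr1n.
split=> //; rewrite distrC; move: gxgle.
rewrite mulgV subrr normr0 max_l ?normr_ge0 // => /le_trans; apply.
apply: le_trans (_ : L2 * (L1 * `|c x - c 1%g|) <= _); first by rewrite ler_pM2l.
by rewrite mulrA distrC ler_wpM2r.
Unshelve. all: by end_near. Qed.

(** One radius and one constant serve all four estimates. The constant is an integer because the
    number of cells is computed from it. *)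
Lemma chart_estimates : compact [set: G] -> exists (r : R) (L : nat), [/\ 0 < r, (0 < L)%N &
  [/\ forall g x, chart_ball r x -> chart_dom c (g * x * g^-1)%g /\
        `|c 1%g - c (g * x * g^-1)%g| <= L%:R * `|c 1%g - c x|,
      forall x, chart_ball r x -> chart_dom c x^-1%g /\
        `|c 1%g - c x^-1%g| <= L%:R * `|c 1%g - c x|,
      forall y z, chart_ball r y -> chart_ball r z -> chart_dom c (y^-1 * z)%g /\
        `|c 1%g - c (y^-1 * z)%g| <= L%:R * `|c y - c z| &
      forall x y, chart_ball r x -> chart_ball r y -> chart_dom c (x * y)%g /\
        `|c (x * y)%g - c x| <= L%:R * `|c 1%g - c y|] ].
Proof.
move=> /conj_estimate[r1 [L1 [r10 L10 H1]]].
have [|r2 [L2 [r20 L20 H2]]] := lie_inv_lipschitz cA cA c1; first by rewrite invg1.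
have [|r3 [L3 [r30 L30 H3]]] := lie_mul_lipschitz cA cA cA c1 c1; first by rewrite mulg1.
(* The last bound keeps inverses in the range of the multiplication estimate. *)
pose r := Num.min r1 (Num.min r2 (Num.min r3 (r3 / L2))).
pose L := (Num.truncn (L1 + L2 + L3)).+1.
have LL : L1 + L2 + L3 < L%:R by exact: truncnS_gt.
have LL1 : L1 <= L%:R by lra.
have LL2 : L2 <= L%:R by lra.
have LL3 : L3 <= L%:R by lra.
have rP x : chart_ball r x -> [/\ chart_dom c x, `|c 1%g - c x| < r1, `|c 1%g - c x| < r2,
    `|c 1%g - c x| < r3 & L2 * `|c 1%g - c x| < r3].
  move=> [xc]; rewrite !lt_min => /and4P[? ? ? x4]; split=> //.
  by rewrite mulrC -ltr_pdivlMr.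
have inv x : chart_ball r x -> chart_dom c x^-1%g /\ `|c 1%g - c x^-1%g| <= L2 * `|c 1%g - c x|.
  move=> /rP[xc _ x2 _ _]; have [|h1] := H2 x 1%g xc c1 x2; first by rewrite subrr normr0.
  by rewrite invg1 distrC [`|c x - _|]distrC.
have z0 (e : R) : 0 < e -> `|c 1%g - c 1%g| < e by rewrite subrr normr0.
exists r, L; split=> //; first by rewrite !lt_min r10 r20 r30 divr_gt0.
split.
- move=> g x /rP[xc x1 _ _ _]; have [h1 h2] := H1 g x (conj xc x1); split=> //.
  by apply: le_trans h2 _; rewrite ler_wpM2r.
- move=> x /inv[h1 h2]; split=> //; apply: le_trans h2 _; by rewrite ler_wpM2r.
- move=> y z yr zr; have [yvc yv] := inv y yr.
  have [yc _ _ y3 y4] := rP _ yr; have [zc _ _ z3 _] := rP _ zr.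
  have yv3 := le_lt_trans yv y4.
  (* The point [y^-1 * z] is compared with [y^-1 * y = 1]. *)
  have [h1] := H3 y^-1%g z y^-1%g y yvc zc yvc yc yv3 z3 yv3 y3.
  rewrite mulVg subrr normr0 max_r ?normr_ge0 // => h2; split=> //.
  by rewrite distrC; apply: le_trans h2 _; rewrite [`|c z - _|]distrC ler_wpM2r.
move=> x y /rP[xc _ _ x3 _] /rP[yc _ _ y3 _].
have [h1] := H3 x y x 1%g xc yc xc c1 x3 y3 x3 (z0 _ r30).
rewrite mulg1 subrr normr0 max_r ?normr_ge0 // => h2; split=> //.
by apply: le_trans h2 _; rewrite distrC ler_wpM2r.
Qed.

End LieGroupCharts.

(** * Cells and scales *)

Lemma continuous_mx_entry (K : numFieldType) (T : topologicalType) m n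
    (f : T -> 'M[K]_(m, n)) i j : continuous f -> continuous (fun x => f x i j).
Proof. by move=> fc x W hW; exact: (fc x _ (@coord_continuous K m n i j (f x) W hW)). Qed.

Section CoveringNumbers.
Context {R : realType} {d : nat} {G : lieGroupType R d}.
Implicit Types (x y z g h X Y : G).

(** Finitely many translates of [S] cover the compact group; [kappa X] is the index of one that
    contains [X]. *)
Lemma finite_translates (S : set G) : compact [set: G] -> nbhs (1%g : G) S ->
  exists (T : finType) (kappa : G -> T) (t : T -> G),
    forall X, S ((t (kappa X))^-1 * X)%g.
Proof.
move=> /compact_near_coveringP Gc S1.
(* Compactness is used along the filter of finite lists ordered by inclusion. *)
pose F := filter_from [set: seq G] (fun s0 : seq G => [set s : seq G | {subset s0 <= s}]).
have FF : Filter F.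
  apply: filter_from_filter; first by exists [::].
  move=> s s' _ _; exists (s ++ s') => // u /= su.
  by split=> x xs; apply: su; rewrite mem_cat xs ?orbT.
have [|s _ /(_ s) cov] := Gc _ F (fun s X => exists2 g, g \in s & S (g^-1 * X)%g) FF.
  move=> g _; exists ([set X | S (g^-1 * X)%g], [set s : seq G | g \in s]).
    split=> /=; last by exists [:: g] => // s; apply; rewrite inE.
    have h : (g^-1 * x)%g @[x --> g] --> (g^-1 * g)%g.
      apply: (@continuous_comp _ _ _ (fun x : G => (g^-1%g, x))
                (fun p : G * G => (p.1 * p.2)%g)); last exact: lie_mul_continuous.
      by apply: (@cvg_pair _ _ _ (nbhs g) (nbhs g^-1%g) (nbhs g)); [exact: cvg_cst|exact: cvg_id].
    by apply: h; rewrite mulVg.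
  by move=> [X s] [/= SX gs]; exists g.
have /choice[k kP] X : exists i : 'I_(size s), S ((nth 1%g s i)^-1 * X)%g.
  have [//|g gs SX] := cov _ X I.
  have lt : (index g s < size s)%N by rewrite index_mem.
  by exists (Ordinal lt); rewrite /= nth_index.
by exists 'I_(size s), k, (fun i : 'I_(size s) => nth 1%g s i).
Qed.

Lemma continuous_repr_bounded n (rho : G -> 'M[R[i]]_n) :
  compact [set: G] -> continuous_repr rho -> mxbounded rho.
Proof.
move=> Gc [_ _ rc].
have entry i j : continuous (fun g => rho g i j : (R[i] : numFieldType)).
  exact: (@continuous_mx_entry (R[i] : numFieldType) G n n rho i j rc).
have bnd (u : G -> R) : continuous u -> exists M : R, forall g, `|u g| <= M.
  move=> uc; have /compact_bounded [M [_ MP]] : compact (u @` setT).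
    by apply: continuous_compact => //; exact: continuous_subspaceT.
  by exists (M + 1) => g; apply: (MP (M + 1)); [rewrite ltrDl|exists g].
have /choice[Mre Pre] (ij : 'I_n * 'I_n) : exists M : R, forall g,
    `|complex.Re (rho g ij.1 ij.2)| <= M.
  by apply: bnd => g; apply: cvg_Re; exact: entry.
have /choice[Mim Pim] (ij : 'I_n * 'I_n) : exists M : R, forall g,
    `|complex.Im (rho g ij.1 ij.2)| <= M.
  by apply: bnd => g; apply: cvg_Im; exact: entry.
pose M ij := Mre ij ^+ 2 + Mim ij ^+ 2.
have M0 ij : 0 <= M ij by rewrite addr_ge0 ?sqr_ge0.
exists (\sum_ij M ij) => g i j.
apply: (@le_trans _ _ (M (i, j))).
  have sq (a b : R) : `|a| <= b -> a ^+ 2 <= b ^+ 2.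
    move=> ab; rewrite -[leLHS]real_normK ?num_real // lerXn2r ?nnegrE //.
    exact: le_trans ab.
  by apply: lerD; apply: sq; [exact: (Pre (i, j))|exact: (Pim (i, j))].
by rewrite (bigD1 (i, j)) //= lerDl sumr_ge0.
Qed.

(** For [m = 2 ^ j] the claim reduces to a linear function of [j] staying below [2 ^ j]. *)
Lemma poly_lt_exp4 (A k : nat) : exists2 m, (0 < m)%N & (4 * (A * m) ^ k < 4 ^ m)%N.
Proof.
(* The factor [4 * A ^ k] is at most [2 ^ a]. With [j = 3 * s], [2 ^ j] is at least the cube of
   [s + 1], which exceeds [a + k * j]. *)
pose a := (A * k + 2)%N; pose s := (a + k)%N; pose j := (3 * s)%N.
have jlt : (a + k * j < 2 ^ j)%N.
  have h : (s.+1 ^ 3 <= 2 ^ j)%N by rewrite /j mulnC expnM leq_exp2r // ltn_expl.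
  have cube b l : (b + l * (3 * (b + l)) < (b + l).+1 ^ 3)%N.
    by rewrite !expnS expn0 muln1; nia.
  exact: leq_trans (cube a k) h.
exists (2 ^ j)%N; first by rewrite expn_gt0.
have -> : (4 ^ (2 ^ j) = 2 ^ (2 * 2 ^ j))%N by rewrite expnM.
apply: (@leq_ltn_trans (2 ^ (a + k * j))%N); last first.
  by rewrite ltn_exp2l // (leq_trans jlt) // leq_pmull.
rewrite expnMn -expnM [(j * k)%N]mulnC [X in (_ <= X)%N]expnD mulnA leq_mul //.
rewrite /a addnC expnD leq_mul // expnM.
case: k {a s j jlt} => [|k]; first by rewrite !expn0.
by rewrite leq_exp2r // ltnW // ltn_expl.
Qed.

Context (c : chart 'rV[R]_d G) (c1 : chart_dom c 1%g).
Local Notation Bc := (chart_ball c).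

Lemma same_cell_close (x y K delta : R) : 0 < delta ->
  0 <= x + K -> 0 <= y + K ->
  Num.truncn ((x + K) / delta) = Num.truncn ((y + K) / delta) ->
  `|x - y| < delta.
Proof.
move=> d0 x0 y0 e.
have /truncn_itv := divr_ge0 x0 (ltW d0); rewrite e => /andP[x1 x2].
have /truncn_itv := divr_ge0 y0 (ltW d0) => /andP[y1 y2].
have -> : x - y = ((x + K) / delta - (y + K) / delta) * delta.
  by field; rewrite gt_eqF.
rewrite normrM (gtr0_norm d0) gtr_pMl // ltr_norml.
move: x1 x2 y1 y2; rewrite -!natr1 => x1 x2 y1 y2.
by apply/andP; split; lra.
Qed.

(** A cube of side [2 * M] around [c X0] is cut along each axis into steps of length [delta];
    truncation takes values from 0 to [N], hence [N.+1]. *)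
Lemma chart_cells (X0 : G) (M delta : R) (N : nat) :
  0 < delta -> 2 * M <= N%:R * delta ->
  exists kappa : G -> {ffun 'I_d -> 'I_N.+1},
    forall X Y, `|c X0 - c X| <= M -> `|c X0 - c Y| <= M -> kappa X = kappa Y ->
    `|c X - c Y| <= delta.
Proof.
move=> d0 MN.
pose p (X : G) i := ((c X - c X0) 0 i + M) / delta.
(* Where an index would exceed [N], [inord] returns a default; this does not happen within [M] of
   [X0]. *)
exists (fun X => [ffun i => inord (Num.truncn (p X i))]) => X Y XM YM e.
have bnd (Z : G) i : `|c X0 - c Z| <= M -> 0 <= (c Z - c X0) 0 i + M <= 2 * M.
  move=> ZM; have := le_trans (rV_coord_le (c Z - c X0) i) _.
  move=> /(_ M); rewrite distrC => /(_ ZM); rewrite ler_norml => /andP[? ?].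
  by apply/andP; split; lra.
have lt (Z : G) i : `|c X0 - c Z| <= M -> (Num.truncn (p Z i) < N.+1)%N.
  move=> /(bnd _ i)/andP[h1 h2]; rewrite ltnS -(@ler_nat R).
  apply: le_trans (_ : p Z i <= _); first by rewrite truncn_le // divr_ge0 // ltW.
  by rewrite ler_pdivrMr //; exact: le_trans MN.
apply: rV_norm_le; first exact: ltW.
move=> i; have /ffunP/(_ i) := e; rewrite !ffunE => /(congr1 val) /=.
rewrite !inordK ?lt // => eT; apply: ltW.
have /andP[x0 _] := bnd X i XM; have /andP[y0 _] := bnd Y i YM.
have -> : (c X - c Y) 0 i = (c X - c X0) 0 i - (c Y - c X0) 0 i by rewrite !mxE; ring.
exact: same_cell_close eT.
Qed.

Context (r : R) (L : nat) (L0 : (0 < L)%N).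
Hypothesis conjE : forall g x, Bc r x -> chart_dom c (g * x * g^-1)%g /\
  `|c 1%g - c (g * x * g^-1)%g| <= L%:R * `|c 1%g - c x|.
Hypothesis invE : forall x, Bc r x -> chart_dom c x^-1%g /\
  `|c 1%g - c x^-1%g| <= L%:R * `|c 1%g - c x|.
Hypothesis mulE : forall x y, Bc r x -> Bc r y -> chart_dom c (x * y)%g /\
  `|c (x * y)%g - c x| <= L%:R * `|c 1%g - c y|.

(** Each letter moves the word by at most [L ^ 3 * s]: one factor [L] for a possible inversion, one
    for conjugation, one for multiplication. The smallness assumption keeps partial words where the
    estimates hold. *)
Lemma conj_word_bound (m : nat) (s : R) x k X : 0 < s ->
  chart_dom c x -> `|c 1%g - c x| <= s -> m.+1%:R * (L%:R ^+ 3 * s) < r ->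
  (k <= m.+1)%N -> conj_word x k X ->
  chart_dom c X /\ `|c 1%g - c X| <= k%:R * (L%:R ^+ 3 * s).
Proof.
move=> s0 xc xs small; have L1 : 1 <= L%:R :> R by rewrite ler1n.
have Lp : 0 < L%:R :> R by exact: lt_le_trans L1.
have u0 : 0 < L%:R ^+ 3 * s by rewrite mulr_gt0 ?exprn_gt0.
have small1 : L%:R ^+ 3 * s < r.
  by apply: le_lt_trans small; rewrite ler_peMl ?(ltW u0) ?ler1n.
have s1 : s <= L%:R * s by rewrite ler_peMl ?(ltW s0).
have s2 : L%:R * s <= L%:R * (L%:R * s) by rewrite ler_pM2l.
have s3 : L%:R * (L%:R * s) <= L%:R ^+ 3 * s.
  have -> : L%:R ^+ 3 * s = L%:R * (L%:R * (L%:R * s)) by ring.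
  by rewrite !ler_pM2l.
have inB y : chart_dom c y -> `|c 1%g - c y| <= L%:R * (L%:R * s) -> Bc r y.
  by move=> yc ys; split=> //; apply: le_lt_trans ys (le_lt_trans s3 small1).
have xB : Bc r x by apply: inB => //; apply: le_trans xs (le_trans s1 s2).
have conjB h : (exists g, h = (g * x * g^-1)%g \/ h = (g * x^-1 * g^-1)%g) ->
    chart_dom c h /\ `|c 1%g - c h| <= L%:R * (L%:R * s).
  move=> [g [->|->]].
    have [h1 h2] := conjE g xB; split=> //; apply: le_trans h2 _.
    by rewrite ler_pM2l //; apply: le_trans xs s1.
  have [i1 i2] := invE xB.
  have i3 : `|c 1%g - c x^-1%g| <= L%:R * s.
    by apply: le_trans i2 _; rewrite ler_pM2l.
  have [h1 h2] := conjE g (inB _ i1 (le_trans i3 s2)); split=> //.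
  by apply: le_trans h2 _; rewrite ler_pM2l.
elim: k X => [|k IH] X km /=.
  by move=> ->; split=> //; rewrite subrr normr0 mul0r.
move=> [w [g [ww Xw]]].
have [wc wk] := IH w (ltnW km) ww.
have [h hP ->] : exists2 h, (exists g, h = (g * x * g^-1)%g \/ h = (g * x^-1 * g^-1)%g)
    & X = (w * h)%g.
  by case: Xw => ->; [exists (g * x * g^-1)%g|exists (g * x^-1 * g^-1)%g];
     rewrite ?mulgA //; exists g; [left|right].
have [hc hs] := conjB h hP.
have wB : Bc r w.
  split=> //; apply: le_lt_trans wk (le_lt_trans _ small).
  by rewrite ler_pM2r // ler_nat ltnW.
have [h1 h2] := mulE wB (inB _ hc hs); split=> //.
rewrite -natr1 mulrDl mul1r -(subrKA (c w)); apply: le_trans (ler_normD _ _) _.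
apply: lerD => //; rewrite distrC; apply: le_trans h2 _.
have -> : L%:R ^+ 3 * s = L%:R * (L%:R * (L%:R * s)) by ring.
by rewrite ler_pM2l.
Qed.

End CoveringNumbers.

(** * The constant, and the cases of large and small scale *)

Theorem theorem18p2 (R : realType) (d : nat) (G : lieGroupType R d)
    (G_connected : connected [set: G]) (G_compact : compact [set: G]) :
  exists2 c : R, 0 < c &
    forall chi : G -> R[i], nontrivial_irreducible_character chi ->
      exists g : G, (complex.Re (chi g))%:C <= - c%:C * chi 1%g.
Proof.
have [c cA c1] := lie_chart_at (1%g : G).
have [r [L [r0 L0 [conjE invE divE mulE]]]] := chart_estimates cA c1 G_compact.
(* The word length depends on [L] and [d] only; it beats the number of cells because
   [N.+1 <= (8 * L ^ 4 + 1) * m.+1]. *)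
have [m' m'0 mP] := poly_lt_exp4 (8 * L ^ 4 + 1) d.
case: m' m'0 mP => // m _ mP.
have LR : 0 < L%:R :> R by rewrite ltr0n.
(* For the scale [rk] below, words stay within [2 * m.+1 * L ^ 3 * rk] of 1 and cells have side
   [rk / (2 * L)]; [N] is twice the first divided by the second. *)
pose N := (8 * m.+1 * L ^ 4)%N.
pose T1 : finType := {ffun 'I_d -> 'I_N.+1}.
have T1m : (4 * #|T1| < 4 ^ m.+1)%N.
  rewrite card_ffun !card_ord; apply: leq_ltn_trans mP; rewrite leq_mul2l /=.
  have leq_exp a b e : (a <= b -> a ^ e <= b ^ e)%N.
    by move=> ab; elim: e => // e IH; rewrite !expnS leq_mul.
  by apply: leq_exp; rewrite /N; nia.
(* Words of length [m.+1] in conjugates of an element within [r1] of 1, or of its inverse, stay in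
   the ball of radius [r]. *)
pose r1 := r / (2 * (m.+1%:R * L%:R ^+ 3) + 1).
have K0 : 0 < m.+1%:R * L%:R ^+ 3 :> R by rewrite mulr_gt0 ?exprn_gt0.
have r10 : 0 < r1 by rewrite divr_gt0 // ltr_wpDl // mulr_ge0 // ltW.
have r1r : 2 * (m.+1%:R * L%:R ^+ 3) * r1 < r.
  rewrite /r1 mulrA ltr_pdivrMr ?ltr_wpDl ?mulr_ge0 ?(ltW K0) //.
  by rewrite mulrC ltr_pM2l // ltrDl.
(* Two elements of the ball of radius [r2] are less than [r1 / L] apart, so their quotient lies in
   the ball of radius [r1]. *)
pose r2 := Num.min r (r1 / L%:R / 2).
have r20 : 0 < r2 by rewrite lt_min r0 !divr_gt0.
have [T2 [kappa2 [t2 kappa2P]]] := finite_translates G_compact (chart_ball_nbhs cA c1 r20).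
have [m2 T2m] : exists m2, (4 * #|T2| < 4 ^ m2)%N.
  by exists (4 * #|T2|)%N; exact: ltn_expl.
pose e1 : R := (4 * #|T1|)%:R^-1; pose e2 : R := (4 * #|T2|)%:R^-1.
have e10 : 0 < e1.
  by rewrite invr_gt0 ltr0n muln_gt0 /= card_ffun !card_ord expn_gt0.
have e20 : 0 < e2.
  by rewrite invr_gt0 ltr0n muln_gt0 /=; apply/card_gt0P; exists (kappa2 1%g).
exists (Num.min e1 e2); first by rewrite lt_min e10.
move=> chi [n [rho [rc irr nontriv chiE]]].
have hr : mxhom rho by case: rc => h1 h2 _; split.
have br := continuous_repr_bounded G_compact rc.
have n0 : 0 < n%:R :> R by rewrite ltr0n irr.1.
have tr1 : complex.Re (\tr (rho 1%g)) = n%:R.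
  by rewrite hr.1 mxtrace1 -(rmorph_nat (real_complex R)).
suff [g [e eP gP]] : exists g, exists2 e, Num.min e1 e2 <= e &
    complex.Re (\tr (rho g)) <= - (e * n%:R).
  exists g; rewrite !chiE hr.1 mxtrace1 -(rmorph_nat (real_complex R)).
  rewrite -rmorphN -rmorphM lecR; apply: le_trans gP _.
  by rewrite mulNr lerN2 ler_pM2r.
pose good s := forall y, chart_ball c s y -> n%:R / 2 <= complex.Re (\tr (rho y)).
have half : n%:R / 2 < n%:R :> R by rewrite ltr_pdivrMr // ltr_pMr // ltr1n.
(* Continuity of the character at 1, read in the chart, makes some dyadic radius good. *)
have [j jgood] : exists j, good (r1 / 2 ^+ j).
  have trc : complex.Re (\tr (rho y)) @[y --> (1%g : G)] --> (n%:R : R).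
    rewrite -tr1; apply: cvg_Re; case: rc => _ _ rc.
    apply: (@cvg_big (R[i] : numFieldType) _ +%R 0 xpredT) => [|i _]; first exact: add_continuous.
    exact: (@continuous_mx_entry (R[i] : numFieldType) G n n rho i i rc).
  have /cvgr_ge /(_ _ half) near1 := trc.
  have [[dop _] [_ codm] [cK _] [_ invc]] := lie_is_chart cA.
  have cc1 : chart_cod c (c 1%g) by have [_ [h _] _ _] := lie_is_chart cA; exact: h.
  have : \forall a \near c 1%g, n%:R / 2 <= complex.Re (\tr (rho (chart_inv c a))).
    have := invc (c 1%g) cc1 [set y | n%:R / 2 <= complex.Re (\tr (rho y))].
    by rewrite cK //; exact.
  move=> /nbhs_normP[s /= s0 sP].
  have [j jP] : exists j, r1 / 2 ^+ j < s.
    exists (Num.truncn (r1 / s)).+1; rewrite ltr_pdivrMr ?exprn_gt0 // mulrC -ltr_pdivrMr //.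
    apply: lt_trans (truncnS_gt _) _; rewrite -natrX ltr_nat ltn_expl //.
  exists j => y [yc ys]; rewrite -(cK y yc); apply: sP; exact: lt_trans ys jP.
have [g0 g0P] := exists_small_trace hr br irr nontriv.
(* The least exponent gives the scale of [rho] up to a factor 2, capped at [r1]. *)
have /ex_minnP[k /asboolP kgood kmin] : exists j, `[< good (r1 / 2 ^+ j) >].
  by exists j; apply/asboolP.
(* Large scale: [r1] itself is good. The cells are translates of a fixed neighbourhood, and the
   element [g0] of small trace may lie anywhere in [G]. *)
case: k kgood kmin => [|k] kgood kmin.
  have [||g gP] := @exists_negative_of_words _ R n rho T2 kappa2 g0 m2 hr br irr g0P.
  - move=> X Y _ _ eXY; have := kappa2P X; have := kappa2P Y.
    rewrite eXY; set t := t2 _; set y := (t^-1 * Y)%g; set x := (t^-1 * X)%g => yB xB.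
    have -> : (X^-1 * Y)%g = (x^-1 * y)%g by rewrite /x /y invgM invgK -mulgA ?mulVKg ?mulKVg.
    have r2r : r2 <= r by rewrite /r2 ge_min lexx.
    have [h1 h2] := divE x y (chart_ballW r2r xB) (chart_ballW r2r yB).
    apply: kgood; split=> //; rewrite expr0 divr1; apply: le_lt_trans h2 _.
    rewrite mulrC -ltr_pdivlMr //.
    have r2h : r2 <= r1 / L%:R / 2 by rewrite /r2 ge_min lexx orbT.
    rewrite -(subrKA (c 1%g)) [ltRHS]splitr; apply: le_lt_trans (ler_normD _ _) _.
    rewrite ltrD //; last by apply: lt_le_trans r2h; exact: yB.2.
    by rewrite distrC; apply: lt_le_trans r2h; exact: xB.2.
  - exact: T2m.
  by exists g; exists e2 => //; rewrite ge_min lexx orbT.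
(* Small scale: [rk] is good but [2 * rk] is not, which supplies an element [x] of small trace
   within [2 * rk] of 1. *)
pose rk := r1 / 2 ^+ k.+1.
have rk0 : 0 < rk by rewrite divr_gt0 // exprn_gt0.
have rkE : 2 * rk = r1 / 2 ^+ k by rewrite /rk exprS; field; rewrite ?expf_neq0.
have [x [xc xs] xP] : exists2 x, chart_ball c (2 * rk) x &
    complex.Re (\tr (rho x)) <= n%:R / 2.
  apply: contrapT => none.
  suff : (k.+1 <= k)%N by rewrite ltnn.
  apply: kmin; apply/asboolP => y yB; apply: ltW; rewrite ltNge; apply/negP => yle.
  apply: none; exists y => //.
  by rewrite rkE.
have rk1 : 2 * rk <= r1.
  by rewrite rkE ler_pdivrMr ?exprn_gt0 // ler_peMr ?(ltW r10) // exprn_ege1 // ler1n.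
have small : m.+1%:R * (L%:R ^+ 3 * (2 * rk)) < r.
  apply: le_lt_trans r1r; rewrite mulrA; apply: (@le_trans _ _ (m.+1%:R * L%:R ^+ 3 * r1)).
    by rewrite ler_pM2l.
  by rewrite ler_pM2r // ler_peMl ?(ltW K0) // ler1n.
have words X : conj_word x m.+1 X ->
    chart_dom c X /\ `|c 1%g - c X| <= m.+1%:R * (L%:R ^+ 3 * (2 * rk)).
  have rk20 : 0 < 2 * rk by rewrite mulr_gt0.
  exact: (conj_word_bound c1 L0 conjE invE mulE rk20 xc (ltW xs) small (leqnn _)).
have delta0 : 0 < rk / (2 * L%:R) by rewrite divr_gt0 // mulr_gt0.
have [|kappa1 kappa1P] := @chart_cells R d G c 1%g
    (m.+1%:R * (L%:R ^+ 3 * (2 * rk))) (rk / (2 * L%:R)) N delta0.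
  have -> : N%:R = 8 * m.+1%:R * L%:R ^+ 4 :> R by rewrite /N natrM natrX natrM.
  rewrite le_eqVlt; apply/orP; left; apply/eqP; field; rewrite gt_eqF //.
have [||g gP] := @exists_negative_of_words _ R n rho T1 kappa1 x m.+1 hr br irr xP.
- move=> X Y Xw Yw eXY; have [Xc Xb] := words X Xw; have [Yc Yb] := words Y Yw.
  have XB : chart_ball c r X by split=> //; exact: le_lt_trans Xb small.
  have YB : chart_ball c r Y by split=> //; exact: le_lt_trans Yb small.
  have [h1 h2] := divE X Y XB YB; apply: kgood; split=> //.
  (* The factor [L] lost in [divE] is offset by the cell side: the quotient is within [rk / 2] of
     1. *)
  apply: le_lt_trans h2 _; rewrite -/rk.
  apply: le_lt_trans (_ : L%:R * (rk / (2 * L%:R)) < rk).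
    by rewrite ler_pM2l //; exact: kappa1P.
  have -> : L%:R * (rk / (2 * L%:R)) = rk / 2 by field; rewrite gt_eqF.
  by rewrite ltr_pdivrMr // ltr_pMr // ltr1n.
- exact: T1m.
by exists g; exists e1 => //; rewrite ge_min lexx.
Qed.
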